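(* Let $A$ and $T$ be free abelian groups with bases $\{a_1,\dots,a_m\}$ and $\{t_1,\dots,t_k\}$ respectively, let $W:=A\wr T$ be their wreath product, and let $B:=\langle\langle A\rangle\rangle_W$ be its base group. Let $\mathcal X=\{f_1,\dots,f_l\}$ be a finite subset of $B$, let $H$ be the subgroup of $W$ generated by $\mathcal X\cup\{t_1,\dots,t_k\}$, and let $G:=W/\langle\langle \mathcal X\rangle\rangle_W$. Then \[\Delta_H^W(n)\preccurlyeq \bigl(\tilde\delta_G(n)\bigr)^k+n^k,\qquad \tilde\delta_G(n)\preccurlyeq \max\bigl\{n^3,\ \bigl(\Delta_H^W(n^2)\bigr)^3\bigr\}.\] In particular, if $k=1$, then $\Delta_H^W(n)\preccurlyeq\tilde\delta_G(n)$.
   Context: Wreath product: for groups $A,T$, $A\wr T=\bigl(\bigoplus_{t\in T}A^t\bigr)\rtimes T$, where $T$ acts by permuting the copies of $A$ via translation of the index; $\bigoplus_{t\in T}A^t$ is the base group. $\langle\langle S\rangle\rangle_K$ denotes the normal closure of $S$ in the group $K$. Relative Dehn function: let $\mathcal S_2$ be the variety of metabelian groups and $\tilde F(X)$ the free metabelian group on a finite set $X$ (the free group on $X$ modulo its second derived subgroup). A finite relative presentation $\mathcal P=\langle X\mid R\rangle_{\mathcal S_2}$ of a metabelian group $G$ consists of finite sets $X$ and $R\subseteq\tilde F(X)$ together with an epimorphism $\tilde F(X)\to G$ whose kernel is $\langle\langle R\rangle\rangle_{\tilde F(X)}$. Every finitely generated metabelian group has such a presentation. For a word $w$ over $X^{\pm1}$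 representing $1$ in $G$, the relative area $\widetilde{\mathrm{Area}}_{\mathcal P}(w)$ is the smallest $l$ such that $w=_{\tilde F(X)}\prod_{i=1}^l g_i^{-1}r_ig_i$ with $r_i\in R\cup R^{-1}$, $g_i\in\tilde F(X)$. The relative Dehn function is $\tilde\delta_{\mathcal P}(n)=\sup\{\widetilde{\mathrm{Area}}_{\mathcal P}(w)\mid w=_G1,\ |w|_X\le n\}$. Up to the equivalence $\approx$ below it does not depend on $\mathcal P$, and it is denoted $\tilde\delta_G$. Distortion function: for a group $W$ with finite generating set $X$ and a subgroup $H$ with finite generating set $Y$, $\Delta_H^W(n)=\sup\{|w|_Y\mid w\in H,\ |w|_X\le n\}$, where $|\cdot|_X,|\cdot|_Y$ are word lengths (the choice of finite generating sets is immaterial up to rescaling by constants). Comparison of functions on $\mathbb N$: $f\preccurlyeq g$ means there is $C>0$ with $f(n)\le Cg(Cn)+Cn+C$ for all $n\in\mathbb N$; $f\approx g$ means $f\preccurlyeq g$ and $g\preccurlyeq f$. *)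

(* Defs.v *)
From HB Require Import structures.
From mathcomp Require Import all_boot all_order ssrint finmap.
From mathcomp Require Import boolp classical_sets.
From Stdlib Require Relation_Operators.

Set Implicit Arguments.
Unset Strict Implicit.
Unset Printing Implicit Defensive.

Local Open Scope classical_set_scope.
Local Open Scope group_scope.

(* Groups are (possibly infinite) [groupType]s, homomorphisms are [{multiplicative G -> H}], subsets are [set G]. *)

Section Subgroups.
Variable K : groupType.
Implicit Types (S H : set K).

Definition is_subgroup H : Prop :=
  [/\ H 1, (forall x y, H x -> H y -> H (x * y)) & (forall x, H x -> H x^-1)].

Definition is_normal_subgroup H : Prop :=
  is_subgroup H /\ (forall x g, H x -> H (x ^ g)).

Definition generated S : set K := smallest is_subgroup S.

Definition normal_closure S : set K := smallest is_normal_subgroup S.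

Definition derived_subgroup H : set K :=
  generated [set z | exists x y, [/\ H x, H y & z = [~ x, y]]].

(* The minimum is 0 by convention when [g] is not in the subgroup generated
   by [S]. *)
Definition word_length S (g : K) : nat :=
  infimum 0%N [set n | exists s : seq K,
    [/\ (forall u, u \in s -> S u \/ S u^-1), \prod_(u <- s) u = g
      & n = size s]].

Lemma generated_subgroup S : is_subgroup (generated S).
Proof.
split=> [M [] [] // | x y Hx Hy M MS | x Hx M MS].
- by case: (MS) => -[_ + _ _]; apply; [apply: Hx | apply: Hy].
- by case: (MS) => -[_ _ + _]; apply; apply: Hx.
Qed.

Lemma normal_closure_normal S : is_normal_subgroup (normal_closure S).
Proof.
split; first split=> [M [] [] [] // | x y Hx Hy M MS | x Hx M MS].
- by case: (MS) => -[[_ + _] _ _]; apply; [apply: Hx | apply: Hy].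
- by case: (MS) => -[[_ _ +] _ _]; apply; apply: Hx.
- by move=> x g Hx M MS; case: (MS) => -[_ + _]; apply; apply: Hx.
Qed.

End Subgroups.

(* [quotient_by S] is K / <<S>>_K; in particular it is K / S when S is itself
   a normal subgroup. *)
Section Quotient.
Variables (K : groupType) (S : set K).
Let N := normal_closure S.

Definition ncl_rel : rel K := fun x y => `[< N (x^-1 * y) >].

Lemma ncl_rel_refl : reflexive ncl_rel.
Proof.
by move=> x; apply/asboolP; rewrite mulVg; case: (normal_closure_normal S) => -[].
Qed.

Lemma ncl_rel_sym : symmetric ncl_rel.
Proof.
have [[_ _ NV] _] := normal_closure_normal S.
by move=> x y; apply/asboolP/asboolP => /NV; rewrite invgM invgK.
Qed.

Lemma ncl_rel_trans : transitive ncl_rel.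
Proof.
have [[_ NM _] _] := normal_closure_normal S.
move=> y x z /asboolP Nxy /asboolP Nyz; apply/asboolP.
by have := NM _ _ Nxy Nyz; rewrite mulgA -(mulgA x^-1) mulgV mulg1.
Qed.

Definition ncl_equiv := EquivRel ncl_rel ncl_rel_refl ncl_rel_sym ncl_rel_trans.

Local Open Scope quotient_scope.

Definition quotient_by : Type := {eq_quot ncl_equiv}.
HB.instance Definition _ := Choice.on quotient_by.

Definition quotient_proj (x : K) : quotient_by := \pi_{eq_quot ncl_equiv} x.

Definition quotient_one : quotient_by := quotient_proj 1.
Definition quotient_inv (x : quotient_by) : quotient_by :=
  quotient_proj (repr x)^-1.
Definition quotient_mul (x y : quotient_by) : quotient_by :=
  quotient_proj (repr x * repr y).

Lemma quotient_proj_eq x y : quotient_proj x = quotient_proj y <-> N (x^-1 * y).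
Proof.
split; first by move=> /eqmodP/asboolP.
by move=> Nxy; apply/eqmodP/asboolP.
Qed.

Lemma quotient_projK (q : quotient_by) : quotient_proj (repr q) = q.
Proof. exact: reprK. Qed.

Lemma quotient_projP (P : quotient_by -> Prop) :
  (forall x, P (quotient_proj x)) -> forall q, P q.
Proof. by move=> Pp q; rewrite -[q]quotient_projK. Qed.

Lemma quotient_projM x y :
  quotient_mul (quotient_proj x) (quotient_proj y) = quotient_proj (x * y).
Proof.
have [[_ NM NV] NJ] := normal_closure_normal S.
have /quotient_proj_eq Nx := quotient_projK (quotient_proj x).
have /quotient_proj_eq Ny := quotient_projK (quotient_proj y).
apply/quotient_proj_eq; rewrite invgM.
have := NM _ _ (NJ _ (repr (quotient_proj y)) Nx) Ny.
by rewrite /conjg !mulgA mulgK.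
Qed.

Lemma quotient_projV x : quotient_inv (quotient_proj x) = quotient_proj x^-1.
Proof.
have [[_ NM NV] NJ] := normal_closure_normal S.
have /quotient_proj_eq Nx := quotient_projK (quotient_proj x).
apply/quotient_proj_eq; rewrite invgK.
by have := NJ _ x^-1 (NV _ Nx); rewrite /conjg invgM !invgK !mulgA mulgV mul1g.
Qed.

Lemma quotient_mulA : associative quotient_mul.
Proof.
by do 3![elim/quotient_projP => ?]; rewrite !quotient_projM mulgA.
Qed.
Lemma quotient_mul1q : left_id quotient_one quotient_mul.
Proof. by elim/quotient_projP => x; rewrite quotient_projM mul1g. Qed.
Lemma quotient_mulq1 : right_id quotient_one quotient_mul.
Proof. by elim/quotient_projP => x; rewrite quotient_projM mulg1. Qed.
Lemma quotient_mulVq : left_inverse quotient_one quotient_inv quotient_mul.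
Proof.
by elim/quotient_projP => x; rewrite quotient_projV quotient_projM mulVg.
Qed.
Lemma quotient_mulqV : right_inverse quotient_one quotient_inv quotient_mul.
Proof.
by elim/quotient_projP => x; rewrite quotient_projV quotient_projM mulgV.
Qed.

HB.instance Definition _ := isGroup.Build quotient_by
  quotient_mulA quotient_mul1q quotient_mulq1 quotient_mulVq quotient_mulqV.

HB.instance Definition _ := isMultiplicative.Build K quotient_by quotient_proj
  (fun x y => esym (quotient_projM x y)).

End Quotient.

(* Words over X^{+1,-1}: the letter [(x, false)] is x and [(x, true)] is x^-1. *)
Definition word (X : Type) : Type := seq (X * bool).

Section WordEval.
Variables (X : Type) (K : groupType) (h : X -> K).

Definition letter_eval (u : X * bool) : K :=
  if u.2 then (h u.1)^-1 else h u.1.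

Definition word_eval (w : word X) : K := \prod_(u <- w) letter_eval u.

End WordEval.

(* The free group on X: words modulo the equivalence relation generated by
   insertion and deletion of pairs of mutually inverse letters. *)
Section FreeGroup.
Variable X : choiceType.

Implicit Types u v w : word X.

Definition letter_inv (a : X * bool) : X * bool := (a.1, ~~ a.2).
Definition word_inv w : word X := rev (map letter_inv w).

Variant cancel_step : word X -> word X -> Prop :=
  CancelStep u v a : cancel_step (u ++ v) (u ++ a :: letter_inv a :: v).

Definition free_rel : rel (word X) :=
  fun v w => `[< Relation_Operators.clos_refl_sym_trans _ cancel_step v w >].

Lemma free_rel_refl : reflexive free_rel.
Proof. by move=> w; apply/asboolP; apply: Relation_Operators.rst_refl. Qed.
Lemma free_rel_sym : symmetric free_rel.
Proof. by move=> v w; apply/asboolP/asboolP; apply: Relation_Operators.rst_sym. Qed.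
Lemma free_rel_trans : transitive free_rel.
Proof.
move=> w u v /asboolP uw /asboolP wv; apply/asboolP.
exact: Relation_Operators.rst_trans uw wv.
Qed.

Definition free_equiv :=
  EquivRel free_rel free_rel_refl free_rel_sym free_rel_trans.

Local Open Scope quotient_scope.

Definition free_group : Type := {eq_quot free_equiv}.
HB.instance Definition _ := Choice.on free_group.

Definition free_class (w : word X) : free_group := \pi_{eq_quot free_equiv} w.
Definition free_one : free_group := free_class [::].
Definition free_inv (x : free_group) : free_group := free_class (word_inv (repr x)).
Definition free_mul (x y : free_group) : free_group :=
  free_class (repr x ++ repr y).

Lemma free_class_eq v w : free_class v = free_class w <->
  Relation_Operators.clos_refl_sym_trans _ cancel_step v w.
Proof.
split; first by move=> /eqmodP/asboolP.
by move=> vw; apply/eqmodP/asboolP.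
Qed.

Lemma free_classK (x : free_group) : free_class (repr x) = x.
Proof. exact: reprK. Qed.

Lemma free_classP (P : free_group -> Prop) :
  (forall w, P (free_class w)) -> forall x, P x.
Proof. by move=> Pp x; rewrite -[x]free_classK. Qed.

Lemma letter_invK : involutive letter_inv.
Proof. by case=> a b; rewrite /letter_inv /= negbK. Qed.

Lemma free_class_step v w : cancel_step v w -> free_class v = free_class w.
Proof. by move=> vw; apply/free_class_eq; apply: Relation_Operators.rst_step. Qed.

Lemma free_class_lift (f : word X -> word X) :
  (forall v w, cancel_step v w -> free_class (f v) = free_class (f w)) ->
  forall v w, free_class v = free_class w -> free_class (f v) = free_class (f w).
Proof.
move=> fstep v w /free_class_eq; elim=> {v w} [v w /fstep //| //| v w _ -> //|].
by move=> u v w _ -> _ ->.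
Qed.

Lemma free_class_cat v v' w w' : free_class v = free_class v' ->
  free_class w = free_class w' -> free_class (v ++ w) = free_class (v' ++ w').
Proof.
move=> vv' ww'; transitivity (free_class (v' ++ w)).
  apply: (free_class_lift (f := cat^~ w)) vv' => {}v {}v' [a b c].
  by rewrite -!catA; apply/free_class_step/CancelStep.
apply: (free_class_lift (f := cat v')) ww' => {}w {}w' [a b c].
by rewrite !catA; apply/free_class_step/CancelStep.
Qed.

Lemma free_class_inv v w : free_class v = free_class w ->
  free_class (word_inv v) = free_class (word_inv w).
Proof.
apply: free_class_lift => {}v {}w [a b c].
rewrite /word_inv !map_cat !rev_cat /= !rev_cons -!cats1 -!catA /=.
by apply/free_class_step; rewrite -{2}[letter_inv c]letter_invK; apply: CancelStep.
Qed.

Lemma free_classM v w :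
  free_mul (free_class v) (free_class w) = free_class (v ++ w).
Proof. by apply: free_class_cat; apply: free_classK. Qed.

Lemma free_classV w : free_inv (free_class w) = free_class (word_inv w).
Proof. by apply: free_class_inv; apply: free_classK. Qed.

Lemma free_mulA : associative free_mul.
Proof. by do 3![elim/free_classP => ?]; rewrite !free_classM catA. Qed.
Lemma free_mul1g : left_id free_one free_mul.
Proof. by elim/free_classP => w; rewrite free_classM. Qed.
Lemma free_mulg1 : right_id free_one free_mul.
Proof. by elim/free_classP => w; rewrite free_classM cats0. Qed.
Lemma free_mulgV : right_inverse free_one free_inv free_mul.
Proof.
elim/free_classP => w; rewrite free_classV free_classM.
elim/last_ind: w => [//|w a IHw]; rewrite /word_inv map_rcons rev_rcons -cats1.
by rewrite -catA -IHw; apply/esym/free_class_step/CancelStep.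
Qed.
Lemma free_mulVg : left_inverse free_one free_inv free_mul.
Proof.
elim/free_classP => w; rewrite -{2}[w](_ : word_inv (word_inv w) = w).
  by rewrite free_classV; have := free_mulgV (free_class (word_inv w));
     rewrite free_classV.
by rewrite /word_inv map_rev revK mapK //; apply: letter_invK.
Qed.

HB.instance Definition _ := isGroup.Build free_group
  free_mulA free_mul1g free_mulg1 free_mulVg free_mulgV.

Definition free_gen (x : X) : free_group := free_class [:: (x, false)].

End FreeGroup.

Section FreeMetabelian.
Variable X : choiceType.

Definition free_metabelian : groupType :=
  quotient_by (derived_subgroup (derived_subgroup [set: free_group X])).

Definition free_metabelian_gen (x : X) : free_metabelian :=
  quotient_proj _ (free_gen x).

End FreeMetabelian.

(* Finite presentations of G relative to the variety of metabelian groups. *)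
Record relative_presentation (G : groupType) := RelativePresentation {
  gens : finType;
  rels : {fset free_metabelian gens};
  pres_map : {multiplicative free_metabelian gens -> G};
  pres_map_surj : forall g : G, exists x, pres_map x = g;
  pres_map_ker : [set x | pres_map x = 1] = normal_closure [set` rels]
}.

Section RelativeDehnFunction.
Variables (G : groupType) (P : relative_presentation G).

Definition free_metabelian_eval : word (gens P) -> free_metabelian (gens P) :=
  word_eval (@free_metabelian_gen (gens P)).

(* The minimum is over a nonempty set as soon as [w] represents 1 in [G]. *)
Definition relative_area (w : word (gens P)) : nat :=
  infimum 0%N [set l | exists g r : 'I_l -> free_metabelian (gens P),
    (forall i, r i \in rels P \/ (r i)^-1 \in rels P) /\
    free_metabelian_eval w = \prod_(i < l) ((g i)^-1 * r i * g i)].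

(* There are finitely many words of length at most [n], so the supremum is a
   maximum. *)
Definition relative_dehn_function (n : nat) : nat :=
  supremum 0%N [set relative_area w | w in
    [set w | pres_map P (free_metabelian_eval w) = 1 /\ (size w <= n)%N]].

End RelativeDehnFunction.

(* [X] and [Y] are meant to be finite sets generating [K] and [H]; the supremum
   is then a maximum. *)
Definition distortion_function (K : groupType) (X H Y : set K) (n : nat) : nat :=
  supremum 0%N [set word_length Y w | w in
    [set w | H w /\ (word_length X w <= n)%N]].

Section FreeAbelian.
Variable K : groupType.

Definition expgz (x : K) (z : int) : K :=
  match z with Posz n => x ^+ n | Negz n => x ^- n.+1 end.

Definition free_abelian_basis (n : nat) (b : 'I_n -> K) : Prop :=
  (forall x y : K, commute x y) /\
  (forall x : K, exists! z : {ffun 'I_n -> int}, x = \prod_(i < n) expgz (b i) (z i)).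

End FreeAbelian.

(* The wreath product of A and T: finitely supported functions T -> A (the
   direct sum of copies of A indexed by T), extended by T acting through
   (s . f) t = f (s^-1 * t). *)
Section Wreath.
Variables A T : groupType.

Definition wreath_base := {fsfun T -> A with 1}.
Implicit Types (f g h : wreath_base) (s t : T).

Definition base_one : wreath_base := [fsfun with 1].
Definition base_mul f g : wreath_base :=
  [fsfun t in (finsupp f `|` finsupp g)%fset => f t * g t | 1].
Definition base_inv f : wreath_base := [fsfun t in finsupp f => (f t)^-1 | 1].
Definition base_shift s f : wreath_base :=
  [fsfun t in [fset s * u | u in finsupp f]%fset => f (s^-1 * t) | 1].

Lemma base_oneE t : base_one t = 1. Proof. by rewrite fsfunE. Qed.
Lemma base_mulE f g t : base_mul f g t = f t * g t.
Proof.
rewrite fsfunE; case: ifPn => //; rewrite in_fsetU negb_or => /andP[nf ng].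
by rewrite !fsfun_dflt // mulg1.
Qed.
Lemma base_invE f t : base_inv f t = (f t)^-1.
Proof. by rewrite fsfunE; case: finsuppP => //; rewrite invg1. Qed.
Lemma base_shiftE s f t : base_shift s f t = f (s^-1 * t).
Proof.
rewrite fsfunE; case: ifPn => // nt; case: finsuppP => // ft.
by case/negP: nt; apply/imfsetP; exists (s^-1 * t); rewrite ?mulVKg.
Qed.

Record wreath := Wreath { wreath_fun : wreath_base; wreath_top : T }.

Definition wreath_pair (x : wreath) := (wreath_fun x, wreath_top x).
Lemma wreath_pairK : cancel wreath_pair (fun p => Wreath p.1 p.2).
Proof. by case. Qed.
HB.instance Definition _ := Choice.copy wreath (can_type wreath_pairK).

Definition wreath_one : wreath := Wreath base_one 1.
Definition wreath_mul (x y : wreath) : wreath :=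
  Wreath (base_mul (wreath_fun x) (base_shift (wreath_top x) (wreath_fun y)))
         (wreath_top x * wreath_top y).
Definition wreath_inv (x : wreath) : wreath :=
  Wreath (base_shift (wreath_top x)^-1 (base_inv (wreath_fun x)))
         (wreath_top x)^-1.

Let wE := (base_oneE, base_mulE, base_invE, base_shiftE).

Lemma wreath_mulA : associative wreath_mul.
Proof.
move=> [f s] [g t] [h u]; congr Wreath; rewrite /= ?mulgA //.
by apply/fsfunP => v; rewrite !wE invgM !mulgA.
Qed.
Lemma wreath_mul1g : left_id wreath_one wreath_mul.
Proof.
move=> [f s]; congr Wreath; rewrite /= ?mul1g //.
by apply/fsfunP => v; rewrite !wE invg1 !mul1g.
Qed.
Lemma wreath_mulg1 : right_id wreath_one wreath_mul.
Proof.
move=> [f s]; congr Wreath; rewrite /= ?mulg1 //.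
by apply/fsfunP => v; rewrite !wE mulg1.
Qed.
Lemma wreath_mulVg : left_inverse wreath_one wreath_inv wreath_mul.
Proof.
move=> [f s]; congr Wreath; rewrite /= ?mulVg //.
by apply/fsfunP => v; rewrite !wE mulVg.
Qed.
Lemma wreath_mulgV : right_inverse wreath_one wreath_inv wreath_mul.
Proof.
move=> [f s]; congr Wreath; rewrite /= ?mulgV //.
by apply/fsfunP => v; rewrite !wE invgK mulVKg mulgV.
Qed.

HB.instance Definition _ := isGroup.Build wreath
  wreath_mulA wreath_mul1g wreath_mulg1 wreath_mulVg wreath_mulgV.

(* A embeds as the copy of index 1. *)
Definition wreath_inA (a : A) : wreath := Wreath [fsfun base_one with 1 |-> a] 1.
Definition wreath_inT (t : T) : wreath := Wreath base_one t.

Definition base_group : set wreath := normal_closure (range wreath_inA).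

End Wreath.

Arguments base_group A T : clear implicits.

Definition dominated (f g : nat -> nat) : Prop :=
  exists2 C : nat, (0 < C)%N & forall n : nat, (f n <= C * g (C * n) + C * n + C)%N.

Notation "f '\preccurlyeq' g" := (dominated f g) (at level 70, no associativity).

(* Main.v *)
(* Write B for the base group, N for the normal closure of the f_i (a subgroup of B)
   and pi : W -> G = W / N.

   Distortion. The presentation map of G lifts to a homomorphism phi from the free
   metabelian group to W. Up to a linear error, an element of H of length n is
   phi(w) for a relation w of length O(n), and phi(w) is a product of area(w)
   conjugates of finitely many elements of N, that is a sum of area(w) translates in B.
   Discard the translates whose supports are not linked to the walk of w in T by a
   chain of overlapping translates: their sum vanishes. The others are visited by a
   closed walk of length O(n + area(w)), which spells phi(w) in H. This gives
   Delta(n) <= C (delta(Cn) + n) for every k, and the powers of k are needed only to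
   be compared with the stated bound. For k = 0 that bound is linear, and one uses
   instead that subgroups of finitely generated abelian groups are undistorted.

   Area. In the free metabelian group choose preimages alpha_i, theta_j of the images
   of a_i, t_j. As c^(xy) = c^(yx) for c in the derived subgroup, the cost of commuting
   alpha_i with a conjugate of alpha_j by a word of length n in the theta_j is O(n),
   so that a word of length n representing 1 in W has area O(n^3). A relation w of G
   spells in W an element of N, of length at most Delta(Cn) in H; rewriting it over the
   f_i and t_j and erasing the f_i bounds area(w) by C (n + Delta(Cn))^3. *)

Require Import Defs.
From mathcomp Require Import all_boot all_order ssralg ssrint finmap zify.
From mathcomp Require Import boolp classical_sets.

Set Implicit Arguments.
Unset Strict Implicit.
Unset Printing Implicit Defensive.

Local Open Scope classical_set_scope.
Local Open Scope group_scope.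

(** * Word length, area and distortion *)

(** The least element of [A] is an infimum, so the choice inside [infimum] ranges over a nonempty
    set and returns a lower bound. *)
Lemma infimum_nat_le (A : set nat) n : A n -> (infimum 0%N A <= n)%N.
Proof.
move=> An; rewrite /infimum; case: ifPn => [//|_].
have [m [Am mmin]] : exists m, A m /\ forall k, A k -> (m <= k)%N.
  have exA : exists i, `[< A i >] by exists n; apply/asboolP.
  case: (ex_minnP exA) => m /asboolP Am mmin; exists m; split=> // k Ak.
  by apply: mmin; apply/asboolP.
case: xgetP => [x _ [lbx _]|/(_ m) []]; first exact: lbx.
by split=> [k /mmin //|k]; apply.
Qed.

Lemma infimum_nat_mem (A : set nat) n : A n -> A (infimum 0%N A).
Proof.
move=> An; rewrite /infimum; case: ifPn => [/eqP A0|_]; first by rewrite A0 in An.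
have [m [Am mmin]] : exists m, A m /\ forall k, A k -> (m <= k)%N.
  have exA : exists i, `[< A i >] by exists n; apply/asboolP.
  case: (ex_minnP exA) => m /asboolP Am mmin; exists m; split=> // k Ak.
  by apply: mmin; apply/asboolP.
case: xgetP => [x _ [lbx ubx]|/(_ m) []]; last by split=> [k /mmin //|k]; apply.
suff -> : x = m by [].
by apply/eqP; rewrite eqn_leq; apply/andP; split; [apply: lbx | apply: ubx => k /mmin].
Qed.

(** The bound [b] matters: an unbounded set has no supremum in [nat] and receives the default value
    0. *)
Lemma supremum_nat_ge (A : set nat) n b :
  (forall k, A k -> (k <= b)%N) -> A n -> (n <= supremum 0%N A)%N.
Proof.
move=> Ab An; apply: (@ge_supremum_Nmem _ nat 0%N A n) => //.
by apply: nat_supremums_neq0; exists b => k /Ab.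
Qed.

Lemma supremum_nat_le (A : set nat) b :
  (forall k, A k -> (k <= b)%N) -> (supremum 0%N A <= b)%N.
Proof.
move=> Ab; rewrite /supremum; case: ifPn => [//|_].
by case: xgetP => [x _ [_]|//]; apply => k /Ab.
Qed.

Lemma uniform_bound (I : finType) (P : I -> nat -> Prop) :
  (forall i m n, (m <= n)%N -> P i m -> P i n) ->
  (forall i, exists n, P i n) -> exists n, forall i, P i n.
Proof.
move=> Pmono /choice[c Pc]; exists (\max_i c i) => i.
by apply: Pmono (Pc i); apply: leq_bigmax.
Qed.

Lemma uniform_bound_seq (I : choiceType) (s : seq I) (P : I -> nat -> Prop) :
  (forall i m n, (m <= n)%N -> P i m -> P i n) ->
  (forall i, i \in s -> exists n, P i n) -> exists n, forall i, i \in s -> P i n.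
Proof.
move=> Pmono Ps.
have [||n Pn] := @uniform_bound (seq_sub s) (fun i => P (val i)).
- by move=> i; apply: Pmono.
- by move=> i; apply: Ps; apply: ssvalP.
- by exists n => i si; apply: (Pn (SeqSub si)).
Qed.

(** * Word length with respect to a set of generators *)

Section WordNorm.
Variable K : groupType.
Implicit Types (S : set K) (g h : K).

(** A relation is safer than the number [word_length]: it fails outside the subgroup generated by
    [S], where [word_length] takes its default value 0. *)
Definition length_le S n g : Prop := exists s : seq K,
  [/\ (forall u, u \in s -> S u \/ S u^-1), \prod_(u <- s) u = g & (size s <= n)%N].

Lemma length_le1 S n : length_le S n 1.
Proof. by exists [::]; split => //; rewrite big_nil. Qed.

Lemma length_leW S m n g : (m <= n)%N -> length_le S m g -> length_le S n g.
Proof. by move=> mn [s [? ? sm]]; exists s; split=> //; apply: leq_trans mn. Qed.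

Lemma length_leM S m n g h :
  length_le S m g -> length_le S n h -> length_le S (m + n) (g * h).
Proof.
move=> [s [Ss <- sm]] [s' [Ss' <- sn]]; exists (s ++ s'); split.
- by move=> u; rewrite mem_cat => /orP[/Ss|/Ss'].
- by rewrite big_cat.
- by rewrite size_cat leq_add.
Qed.

Lemma length_leV S n g : length_le S n g -> length_le S n g^-1.
Proof.
move=> [s [Ss <- sn]]; exists (rev (map inv s)); split.
- move=> u; rewrite mem_rev => /mapP[v /Ss Sv ->]; rewrite invgK.
  by case: Sv; [right | left].
- elim: s {Ss sn} => [|x s IHs]; first by rewrite !big_nil invg1.
  by rewrite /= rev_cons big_rcons /= IHs big_cons invgM.
- by rewrite size_rev size_map.
Qed.

Lemma length_le_gen S g : S g -> length_le S 1 g.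
Proof.
move=> Sg; exists [:: g]; split=> //; last by rewrite big_seq1.
by move=> u; rewrite inE => /eqP ->; left.
Qed.

Lemma length_leX S n g m : length_le S n g -> length_le S (m * n) (g ^+ m).
Proof.
move=> Sg; elim: m => [|m IHm]; first exact: length_le1.
by rewrite expgS mulSn; apply: length_leM.
Qed.

Lemma length_le_trans S S' c n g :
  (forall u, S u -> length_le S' c u) -> length_le S n g -> length_le S' (c * n) g.
Proof.
move=> SS' [s [Ss <- sn]]; apply: (@length_leW _ (c * size s)); first by rewrite leq_mul2l sn orbT.
elim: s Ss {sn} => [|x s IHs] Ss; first by rewrite big_nil; apply: length_le1.
rewrite big_cons mulnS; apply: length_leM; last first.
  by apply: IHs => u su; apply: Ss; rewrite inE su orbT.
have [/SS' //|/SS' /length_leV] : S x \/ S x^-1 by apply: Ss; rewrite inE eqxx.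
by rewrite invgK.
Qed.

Lemma subgroup_prod (H : set K) (s : seq K) : is_subgroup H ->
  (forall u, u \in s -> H u \/ H u^-1) -> H (\prod_(u <- s) u).
Proof.
move=> [H1 HM HV]; elim: s => [|x s IHs] Hs; first by rewrite big_nil.
rewrite big_cons; apply: HM.
  have [//|/HV] : H x \/ H x^-1 by apply: Hs; rewrite inE eqxx.
  by rewrite invgK.
by apply: IHs => u su; apply: Hs; rewrite inE su orbT.
Qed.

Lemma length_le_generated S n g : length_le S n g -> generated S g.
Proof.
move=> [s [Ss <- _]]; apply: subgroup_prod; first exact: generated_subgroup.
by move=> u /Ss [] Su; [left | right]; apply: sub_gen_smallest.
Qed.

Lemma generated_length_le S g : generated S g -> exists n, length_le S n g.
Proof.
move=> Sg; apply: (Sg [set g | exists n, length_le S n g]).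
split=> [|x /length_le_gen Sx]; last by exists 1%N.
split=> [|x y [m Sx] [n Sy]|x [n Sx]].
- by exists 0%N; apply: length_le1.
- by exists (m + n)%N; apply: length_leM.
- by exists n; apply: length_leV.
Qed.

Lemma word_length_le S n g : length_le S n g -> (word_length S g <= n)%N.
Proof.
by move=> [s [Ss sg sn]]; apply: leq_trans sn; apply: infimum_nat_le; exists s.
Qed.

Lemma length_le_word_length S g : generated S g -> length_le S (word_length S g) g.
Proof.
move=> /generated_length_le [n [s [Ss sg _]]].
have [|s' [Ss' s'g sz]] := @infimum_nat_mem
  [set n | exists s : seq K, [/\ forall u, u \in s -> S u \/ S u^-1,
     \prod_(u <- s) u = g & n = size s]] (size s); first by exists s.
by exists s'; split=> //; rewrite -sz.
Qed.

Lemma generated_gen S S' : (forall g, S g -> generated S' g) ->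
  forall g, generated S g -> generated S' g.
Proof.
move=> SS' g; apply; split; [exact: generated_subgroup | exact: SS'].
Qed.

Lemma finite_length_bound (s : seq K) S : (forall g, g \in s -> generated S g) ->
  exists c, forall g, g \in s -> length_le S c g.
Proof.
move=> sS; apply: (@uniform_bound_seq _ s (fun g n => length_le S n g)).
  by move=> g m n; apply: length_leW.
by move=> g /sS /generated_length_le.
Qed.

Lemma length_le_prod S c (s : seq K) (F : K -> K) :
  (forall x, x \in s -> length_le S c (F x)) ->
  length_le S (c * size s) (\prod_(x <- s) F x).
Proof.
elim: s => [|x s IHs] sF; first by rewrite big_nil; apply: length_le1.
rewrite big_cons mulnS; apply: length_leM; first by apply: sF; rewrite inE eqxx.
by apply: IHs => y ys; apply: sF; rewrite inE ys orbT.
Qed.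

End WordNorm.

(** * Finiteness of balls and the distortion function *)

Section BoundedLengthFinite.
Variables (K : groupType) (S : {fset K}).

(** Splitting off the first letter bounds each ball by the previous one. Finite balls make the
    supremum in the distortion function a maximum instead of a default value. *)
Lemma length_le_finite n : exists s : seq K, forall g, length_le [set` S] n g -> g \in s.
Proof.
elim: n => [|n [s IHs]].
  by exists [:: 1] => g [[|x w] [_ <- //] _]; rewrite big_nil inE.
exists (s ++ [seq x * y | x <- (S : seq K) ++ map inv S, y <- s]) => g [[|x w] [Sw <- sz]].
  by rewrite mem_cat IHs // big_nil; apply: length_le1.
rewrite big_cons mem_cat; apply/orP; right; apply/allpairsP.
exists (x, \prod_(u <- w) u); split=> //=.
  rewrite mem_cat; have [Sx|Sx] := Sw x (mem_head _ _); first by rewrite [X in X || _]Sx.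
  by apply/orP; right; apply/mapP; exists x^-1; rewrite ?invgK.
by apply: IHs; exists w; split=> // u uw; apply: Sw; rewrite inE uw orbT.
Qed.

End BoundedLengthFinite.

Section Distortion.
Variables (K : groupType) (S : {fset K}) (H Y : set K).
Hypothesis genS : generated [set` S] = [set: K].

Lemma distortion_ge g n : H g -> length_le [set` S] n g ->
  (word_length Y g <= distortion_function [set` S] H Y n)%N.
Proof.
move=> Hg Sg; have [s Ps] := length_le_finite S n.
apply: (@supremum_nat_ge _ _ (\max_(g <- s) word_length Y g)).
  move=> k /= [w [Hw wn]] <-; have sw : w \in s.
    by apply/Ps/(length_leW wn)/length_le_word_length; rewrite genS.
  exact: (leq_bigmax_seq (F := word_length Y)).
by exists g => //; split=> //; apply: word_length_le.
Qed.

Lemma distortion_le n b :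
  (forall g, H g -> length_le [set` S] n g -> length_le Y b g) ->
  (distortion_function [set` S] H Y n <= b)%N.
Proof.
move=> SY; apply: supremum_nat_le => k [w [Hw wn] <-]; apply/word_length_le/SY => //.
by apply/(length_leW wn)/length_le_word_length; rewrite genS.
Qed.

Lemma distortion_mono m n : (m <= n)%N ->
  (distortion_function [set` S] H Y m <= distortion_function [set` S] H Y n)%N.
Proof.
move=> mn; apply: supremum_nat_le => k [w [Hw wm] <-]; apply: distortion_ge => //.
by apply/(length_leW (leq_trans wm mn))/length_le_word_length; rewrite genS.
Qed.

End Distortion.

(** * Area and approximate commutation *)

Section Area.
Variable K : groupType.
Implicit Types (R : set K) (g x y z : K).

(** A pair [(r, g)] stands for the conjugate [r ^ g]. As with [length_le], no default value arises
    outside the normal closure of [R]. *)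
Definition area_le R n g : Prop := exists s : seq (K * K),
  [/\ (forall u, u \in s -> R u.1 \/ R u.1^-1),
      g = \prod_(u <- s) u.1 ^ u.2 & (size s <= n)%N].

Lemma area_le1 R n : area_le R n 1.
Proof. by exists [::]; split => //; rewrite big_nil. Qed.

Lemma area_leW R m n g : (m <= n)%N -> area_le R m g -> area_le R n g.
Proof. by move=> mn [s [? ? sm]]; exists s; split=> //; apply: leq_trans mn. Qed.

Lemma area_leM R m n g h : area_le R m g -> area_le R n h -> area_le R (m + n) (g * h).
Proof.
move=> [s [Ss -> sm]] [s' [Ss' -> sn]]; exists (s ++ s'); split.
- by move=> u; rewrite mem_cat => /orP[/Ss|/Ss'].
- by rewrite big_cat.
- by rewrite size_cat leq_add.
Qed.

Lemma area_leV R n g : area_le R n g -> area_le R n g^-1.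
Proof.
move=> [s [Ss -> sn]]; exists (rev [seq (u.1^-1, u.2) | u <- s]); split.
- move=> u; rewrite mem_rev => /mapP[v /Ss Sv ->]; rewrite invgK.
  by case: Sv; [right | left].
- elim: s {Ss sn} => [|x s IHs]; first by rewrite !big_nil invg1.
  by rewrite /= rev_cons big_rcons /= -IHs big_cons invgM conjVg.
- by rewrite size_rev size_map.
Qed.

Lemma area_leJ R n g x : area_le R n g -> area_le R n (g ^ x).
Proof.
move=> [s [Ss -> sn]]; exists [seq (u.1, u.2 * x) | u <- s]; split.
- by move=> u /mapP[v /Ss Sv ->].
- by rewrite conjg_prod big_map; apply: eq_bigr => u _; rewrite conjgM.
- by rewrite size_map.
Qed.

Lemma normal_closure_area R g : normal_closure R g -> exists n, area_le R n g.
Proof.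
move=> Rg; apply: (Rg [set g | exists n, area_le R n g]); split=> [|x Rx].
  split=> [|x y [n Rx]]; last by exists n; apply: area_leJ.
  split=> [|x y [m Rx] [n Ry]|x [n Rx]].
  - by exists 0%N; apply: area_le1.
  - by exists (m + n)%N; apply: area_leM.
  - by exists n; apply: area_leV.
exists 1%N, [:: (x, 1)]; split=> //; last by rewrite big_seq1 conjg1.
by move=> u; rewrite inE => /eqP ->; left.
Qed.

(* [x] and [y] are at distance at most [n] for a bi-invariant extended metric. *)
Definition near R n x y := area_le R n (x / y).

Lemma nearxx R n x : near R n x x.
Proof. by rewrite /near mulgV; apply: area_le1. Qed.

Lemma nearW R m n x y : (m <= n)%N -> near R m x y -> near R n x y.
Proof. exact: area_leW. Qed.

Lemma near_sym R n x y : near R n x y -> near R n y x.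
Proof. by rewrite /near -invgF => /area_leV; rewrite invgK. Qed.

Lemma near_trans R m n y x z : near R m x y -> near R n y z -> near R (m + n) x z.
Proof. by move=> xy yz; rewrite /near -(divgKA y); apply: area_leM. Qed.

Lemma nearM R m n x x' y y' :
  near R m x x' -> near R n y y' -> near R (m + n) (x * y) (x' * y').
Proof.
move=> xx' yy'; rewrite /near; suff -> : x * y / (x' * y') = x / x' * (y / y') ^ x'^-1.
  by apply: area_leM xx' _; apply: area_leJ.
by rewrite conjgE invgK invgM -!mulgA mulKg.
Qed.

Lemma nearMl R n x y y' : near R n y y' -> near R n (x * y) (x * y').
Proof. by move=> yy'; apply: (@nearM R 0 n) => //; apply: nearxx. Qed.

Lemma nearMr R n x x' y : near R n x x' -> near R n (x * y) (x' * y).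
Proof. by move=> xx'; rewrite -[n]addn0; apply: nearM => //; apply: nearxx. Qed.

Lemma nearV R n x y : near R n x y -> near R n x^-1 y^-1.
Proof.
move=> xy; rewrite /near invgK; have := area_leJ y (near_sym xy).
by suff -> : (y / x) ^ y = x^-1 * y by []; rewrite conjgE -mulgA mulKg.
Qed.

Lemma nearJ R n x y z : near R n x y -> near R n (x ^ z) (y ^ z).
Proof. by move=> xy; apply: nearMl; apply: nearMr. Qed.

Lemma near_commute R n x y : near R n (x * y) (y * x) <-> near R n (x ^ y) x.
Proof.
rewrite conjgE; split=> [xy|/nearMl]; last by move=> /(_ y); rewrite mulVKg.
by rewrite -{2}[x](mulKg y); apply: nearMl.
Qed.

Definition comm_near R n x y := near R n (x * y) (y * x).

Lemma comm_near_sym R n x y : comm_near R n x y -> comm_near R n y x.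
Proof. exact: near_sym. Qed.

Lemma comm_nearW R m n x y : (m <= n)%N -> comm_near R m x y -> comm_near R n x y.
Proof. exact: nearW. Qed.

Lemma comm_nearM R m n x y z :
  comm_near R m x y -> comm_near R n x z -> comm_near R (m + n) x (y * z).
Proof.
move=> xy xz; rewrite /comm_near.
apply: (@near_trans _ _ _ (y * x * z)); first by rewrite mulgA; apply: nearMr.
by rewrite -!mulgA; apply: nearMl.
Qed.

Lemma comm_nearV R n x y : comm_near R n x y -> comm_near R n x y^-1.
Proof.
move=> /near_commute xy; apply/near_commute; apply: near_sym.
by have := nearJ y^-1 xy; rewrite conjgK.
Qed.

Lemma comm_nearJ R n x y z : comm_near R n x y -> comm_near R n (x ^ z) (y ^ z).
Proof. by move=> /(nearJ z); rewrite !conjMg. Qed.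

End Area.

(** * Words, homomorphisms and substitutions *)

Section Words.
Variables (X : choiceType) (K : groupType).
Implicit Types (h : X -> K) (w : word X).

Lemma word_eval_nil h : word_eval h [::] = 1.
Proof. exact: big_nil. Qed.

Lemma word_eval_cons h u w : word_eval h (u :: w) = letter_eval h u * word_eval h w.
Proof. exact: big_cons. Qed.

Lemma word_eval_cat h v w : word_eval h (v ++ w) = word_eval h v * word_eval h w.
Proof. exact: big_cat. Qed.

Lemma letter_evalV h u : letter_eval h (letter_inv u) = (letter_eval h u)^-1.
Proof. by case: u => x [] /=; rewrite /letter_eval //= invgK. Qed.

Lemma word_eval_inv h w : word_eval h (word_inv w) = (word_eval h w)^-1.
Proof.
elim: w => [|u w IHw]; first by rewrite /word_eval !big_nil invg1.
rewrite /word_inv /= rev_cons -cats1 word_eval_cat IHw [in RHS]word_eval_cons invgM.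
by congr (_ * _); rewrite /word_eval big_seq1 letter_evalV.
Qed.

Lemma size_word_inv w : size (word_inv w) = size w.
Proof. by rewrite size_rev size_map. Qed.

Lemma word_eval_near R n h h' w : (forall x, near R n (h x) (h' x)) ->
  near R (n * size w) (word_eval h w) (word_eval h' w).
Proof.
move=> hh'; elim: w => [|[x b] w IHw]; first by rewrite !word_eval_nil; apply: nearxx.
rewrite !word_eval_cons mulnS; apply: nearM IHw.
by rewrite /letter_eval; case: b => /=; first apply: nearV; apply: hh'.
Qed.

Lemma word_eval_length S n h w : (forall x, length_le S n (h x)) ->
  length_le S (n * size w) (word_eval h w).
Proof.
move=> hS; elim: w => [|[x b] w IHw]; first by rewrite word_eval_nil; apply: length_le1.
rewrite word_eval_cons mulnS; apply: length_leM IHw.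
by rewrite /letter_eval; case: b => /=; first apply: length_leV; apply: hS.
Qed.

Lemma length_le_word h n g :
  length_le (range h) n g -> exists2 w, (size w <= n)%N & word_eval h w = g.
Proof.
move=> [s [hs <- sn]].
suff [w sw ws] : exists2 w, size w = size s & word_eval h w = \prod_(u <- s) u.
  by exists w; rewrite ?sw.
elim: s hs {sn} => [|u s IHs] hs; first by exists [::]; rewrite // word_eval_nil big_nil.
have [|w sw ws] := IHs; first by move=> v vs; apply: hs; rewrite inE vs orbT.
have [|[x _ xu]|[x _ xu]] := hs u; first by rewrite inE eqxx.
- by exists ((x, false) :: w); rewrite /= ?sw // word_eval_cons big_cons ws -xu.
- exists ((x, true) :: w); rewrite /= ?sw // word_eval_cons big_cons ws.
  by rewrite /letter_eval /= xu invgK.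
Qed.

End Words.

Section GroupMorphism.
Variables (K L : groupType) (phi : K -> L).
Hypothesis phiM : {morph phi : x y / x * y}.

Lemma morph_one : phi 1 = 1.
Proof. by apply: (mulgI (phi 1)); rewrite -phiM !mulg1. Qed.

Lemma morph_inv x : phi x^-1 = (phi x)^-1.
Proof. by apply: (mulgI (phi x)); rewrite -phiM !mulgV morph_one. Qed.

Lemma morph_conj x y : phi (x ^ y) = phi x ^ phi y.
Proof. by rewrite !conjgE !phiM morph_inv. Qed.

Lemma morph_comm x y : phi [~ x, y] = [~ phi x, phi y].
Proof. by rewrite !commgEl phiM morph_inv morph_conj. Qed.

Lemma morph_prod I (s : seq I) (F : I -> K) :
  phi (\prod_(i <- s) F i) = \prod_(i <- s) phi (F i).
Proof. exact: (big_morph phi phiM morph_one). Qed.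

Lemma morph_word_eval (X : choiceType) (h : X -> K) w :
  phi (word_eval h w) = word_eval (phi \o h) w.
Proof.
rewrite /word_eval morph_prod; apply: eq_bigr => -[x b] _.
by case: b; rewrite /letter_eval //= morph_inv.
Qed.

Lemma is_subgroup_preim (H : set L) : is_subgroup H -> is_subgroup (phi @^-1` H).
Proof.
move=> [H1 HM HV]; split=> [|x y|x]; rewrite /preimage /= ?morph_one ?phiM ?morph_inv //.
- exact: HM.
- exact: HV.
Qed.

Lemma is_normal_preim (H : set L) :
  is_normal_subgroup H -> is_normal_subgroup (phi @^-1` H).
Proof.
move=> [Hsub HJ]; split; first exact: is_subgroup_preim.
by move=> x g; rewrite /preimage /= morph_conj; apply: HJ.
Qed.

End GroupMorphism.

Lemma is_normal_trivial (K : groupType) : is_normal_subgroup [set (1 : K)].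
Proof.
by split; [split=> [|x y -> ->|x ->] |move=> x g ->]; rewrite /= ?mulg1 ?invg1 ?conj1g.
Qed.

Section Substitution.
Variables (X Z : choiceType) (sigma : X -> word Z).

Definition subst_letter (u : X * bool) : word Z :=
  if u.2 then word_inv (sigma u.1) else sigma u.1.

Definition subst_word (w : word X) : word Z := flatten (map subst_letter w).

Lemma word_eval_subst (K : groupType) (h : Z -> K) w :
  word_eval h (subst_word w) = word_eval (fun x => word_eval h (sigma x)) w.
Proof.
elim: w => [|[x b] w IHw]; first by rewrite !word_eval_nil.
rewrite /subst_word /= word_eval_cat IHw word_eval_cons; congr (_ * _).
by case: b => //=; rewrite word_eval_inv.
Qed.

Lemma size_subst n w : (forall x, (size (sigma x) <= n)%N) ->
  (size (subst_word w) <= n * size w)%N.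
Proof.
move=> sn; elim: w => [|[x b] w IHw] //.
rewrite /subst_word /= size_cat mulnS leq_add //.
by case: b => //=; rewrite ?size_word_inv; apply: sn.
Qed.

End Substitution.

(** * Free abelian bases and nearly commuting words *)

Section IntPowers.
Variable K : groupType.
Implicit Types (x y : K) (z : int).

Lemma expgzS x z : expgz x (z + 1)%R = expgz x z * x.
Proof.
case: z => n.
  by rewrite (_ : (Posz n + 1)%R = Posz n.+1) /= ?expgSr //; lia.
case: n => [|n]; first by rewrite /= mulVg.
rewrite (_ : (Negz n.+1 + 1)%R = Negz n); last by lia.
by rewrite /= [in RHS]expgS invgM mulgVK.
Qed.

Lemma expgzD x z z' : expgz x (z + z')%R = expgz x z * expgz x z'.
Proof.
elim: z' => [|n IHn|n IHn]; first by rewrite GRing.addr0 /= mulg1.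
  by rewrite -addn1 PoszD GRing.addrA !expgzS IHn mulgA.
apply: (mulIg x); rewrite -mulgA -!expgzS -GRing.addrA.
by rewrite (_ : (- n.+1%:Z + 1 = - n%:Z)%R) ?IHn //; lia.
Qed.

Lemma length_le_expgz S n x z :
  length_le S n x -> length_le S (`|z|%N * n) (expgz x z).
Proof.
by move=> Sx; case: z => k /=; first apply: length_leX; last apply/length_leV/length_leX.
Qed.

Lemma comm_near_expgz R n x y z :
  comm_near R n x y -> comm_near R (n * `|z|%N) x (expgz y z).
Proof.
move=> xy; have xyX k : comm_near R (n * k) x (y ^+ k).
  elim: k => [|k IHk]; first by rewrite /comm_near mulg1 mul1g; apply: nearxx.
  by rewrite expgS mulnS; apply: comm_nearM.
by case: z => k /=; last apply: comm_nearV; apply: xyX.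
Qed.

End IntPowers.

(** * Coordinates and normal forms for a free abelian basis *)

Section Coordinates.
Variables (m : nat) (A : groupType) (a : 'I_m -> A).
Hypothesis ha : free_abelian_basis a.

Definition coord (x : A) : {ffun 'I_m -> int} := projT1 (cid (ha.2 x)).

Lemma coordE x : x = \prod_(i < m) expgz (a i) (coord x i).
Proof. by rewrite /coord; case: cid => z []. Qed.

Lemma coord_uniq x (z : 'I_m -> int) :
  x = \prod_(i < m) expgz (a i) (z i) -> forall i, coord x i = z i.
Proof.
move=> xz i; rewrite /coord; case: cid => z' [_ /(_ [ffun i => z i])] /= ->.
  by rewrite ffunE.
by rewrite xz; apply: eq_bigr => j _; rewrite ffunE.
Qed.

Lemma coordM x y i : coord (x * y) i = (coord x i + coord y i)%R.
Proof.
apply: (coord_uniq (z := fun i => (coord x i + coord y i)%R)).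
rewrite {1}(coordE x) {1}(coordE y) -prodgM_commute; last by move=> *; apply: ha.1.
by apply: eq_bigr => j _; rewrite expgzD.
Qed.

Lemma coord1 i : coord 1 i = 0%R.
Proof. by have := coordM 1 1 i; rewrite mulg1; lia. Qed.

Lemma coordV x i : coord x^-1 i = (- coord x i)%R.
Proof. by have := coordM x x^-1 i; rewrite mulgV coord1; lia. Qed.

Lemma coord_gen i j : coord (a i) j = Posz (j == i).
Proof.
apply: (coord_uniq (z := fun j => Posz (j == i))).
have {1}-> : a i = \prod_(k < m | k == i) a k by rewrite big_pred1_eq.
by rewrite big_mkcond; apply: eq_bigr => k _; case: (k == i).
Qed.

Definition coord_norm (x : A) : nat := (\sum_(i < m) `|coord x i|)%N.

Lemma coord_norm1 : coord_norm 1 = 0%N.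
Proof. by rewrite /coord_norm big1 // => i _; rewrite coord1. Qed.

Lemma coord_norm_letter x u : (coord_norm (x * letter_eval a u) <= (coord_norm x).+1)%N.
Proof.
case: u => i b; rewrite /coord_norm (bigD1 i) //= [in leqRHS](bigD1 i) //=.
rewrite -addSn leq_add //.
  rewrite coordM; case: b; rewrite /letter_eval /= ?coordV coord_gen eqxx; lia.
apply: leq_sum => j ji; rewrite coordM.
by case: b; rewrite /letter_eval /= ?coordV coord_gen (negbTE ji); lia.
Qed.

Section Lift.
Variables (E : groupType) (alpha : 'I_m -> E).

(* A set-theoretic section: it is not multiplicative unless the [alpha i] commute. *)
Definition basis_lift (x : A) : E := \prod_(i < m) expgz (alpha i) (coord x i).

Lemma basis_lift1 : basis_lift 1 = 1.
Proof. by rewrite /basis_lift big1 // => i _; rewrite coord1. Qed.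

Lemma length_le_prod_expgz (s : seq 'I_m) (z : 'I_m -> int) :
  length_le (range alpha) (\sum_(i <- s) `|z i|)%N (\prod_(i <- s) expgz (alpha i) (z i)).
Proof.
elim: s => [|i s IHs]; first by rewrite !big_nil; apply: length_le1.
rewrite !big_cons; apply: length_leM IHs; rewrite -[X in length_le _ X _]muln1.
by apply/length_le_expgz/length_le_gen; exists i.
Qed.

Lemma length_le_basis_lift x : length_le (range alpha) (coord_norm x) (basis_lift x).
Proof. exact: length_le_prod_expgz. Qed.

Variables (R : set E) (c : nat).
Hypothesis alphaC : forall i j, comm_near R c (alpha i) (alpha j).

Lemma comm_near_prod_expgz j (s : seq 'I_m) (z : 'I_m -> int) :
  comm_near R (c * \sum_(i <- s) `|z i|)%N (alpha j) (\prod_(i <- s) expgz (alpha i) (z i)).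
Proof.
elim: s => [|i s IHs]; first by rewrite !big_nil /comm_near mulg1 mul1g; apply: nearxx.
rewrite !big_cons mulnDr; apply: comm_nearM IHs.
exact/comm_near_expgz/alphaC.
Qed.

(** The factor [alpha j] moves left past the powers that follow its own slot, at cost [c] per letter
    passed. As [s] is duplicate-free, only one exponent changes. *)
Lemma prod_expgz_step j (s : seq 'I_m) (z : 'I_m -> int) : uniq s -> j \in s ->
  near R (c * \sum_(i <- s) `|z i|)%N
    (\prod_(i <- s) expgz (alpha i) (z i) * alpha j)
    (\prod_(i <- s) expgz (alpha i) (z i + Posz (i == j))%R).
Proof.
elim: s => [//|i s IHs] /= /andP[nis us]; rewrite inE !big_cons mulnDr.
case: (eqVneq i j) => [<- _|ij].
  rewrite (_ : \prod_(_ <- s) expgz _ (_ + _)%R = \prod_(i <- s) expgz (alpha i) (z i)).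
    rewrite expgzS -!mulgA; apply/nearMl/near_sym.
    by apply: nearW (comm_near_prod_expgz i s z); rewrite leq_addl.
  apply: eq_big_seq => k ks; case: eqVneq => [ki|_]; last by rewrite GRing.addr0.
  by rewrite -ki ks in nis.
rewrite /= GRing.addr0 -!mulgA => /(IHs us) js; apply: nearMl.
by apply: nearW js; rewrite leq_addl.
Qed.

Lemma basis_lift_gen x j :
  near R (c * coord_norm x) (basis_lift x * alpha j) (basis_lift (x * a j)).
Proof.
have := @prod_expgz_step j (index_enum 'I_m) (coord x) (index_enum_uniq _) (mem_index_enum _).
congr (near _ _ _ _); apply: eq_bigr => i _; congr (expgz _ _).
by rewrite coordM coord_gen.
Qed.

(** An inverse letter is the positive case read backwards from [x / a j], whose norm may exceed that
    of [x] by one; hence the successor. *)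
Lemma basis_lift_letter x u :
  near R (c * (coord_norm x).+1) (basis_lift x * letter_eval alpha u)
    (basis_lift (x * letter_eval a u)).
Proof.
case: u => j b; have xj := coord_norm_letter x (j, b); move: xj.
rewrite /letter_eval; case: b => /= xj.
  have /(nearMr (alpha j)^-1)/near_sym := basis_lift_gen (x / a j) j.
  by rewrite mulgK mulgVK; apply: nearW; rewrite leq_mul2l xj orbT.
by apply: nearW (basis_lift_gen x j); rewrite leq_mul2l leqnSn orbT.
Qed.

End Lift.

End Coordinates.

(** * Balanced words over nearly commuting letters *)

Section BalancedWords.
Variables (X : choiceType) (E : groupType) (R : set E) (h : X -> E) (M : nat).

Lemma comm_near_letter u v : comm_near R M (h u.1) (h v.1) ->
  comm_near R M (letter_eval h u) (letter_eval h v).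
Proof.
case: u v => [x b] [y b'] /= xy; have {}xy : comm_near R M (h x) (letter_eval h (y, b')).
  by case: b'; rewrite /letter_eval /= //; apply: comm_nearV.
by case: b; rewrite {1}/letter_eval //=; apply/comm_near_sym/comm_nearV/comm_near_sym.
Qed.

Lemma comm_near_word u s :
  (forall v, v \in s -> comm_near R M (h v.1) (h u.1)) ->
  comm_near R (M * size s) (letter_eval h u) (word_eval h s).
Proof.
elim: s => [|v s IHs] hs.
  by rewrite word_eval_nil /comm_near mulg1 mul1g; apply: nearxx.
rewrite word_eval_cons mulnS; apply: comm_nearM.
  by apply/comm_near_sym/comm_near_letter/hs; rewrite inE eqxx.
by apply: IHs => w ws; apply: hs; rewrite inE ws orbT.
Qed.

(** The first letter is carried to an occurrence of its inverse, at cost [M] per letter passed, and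
    cancelled there. Each cancellation passes fewer than [size s] letters and shortens the word, so
    the total is quadratic. *)
Lemma balanced_near1 (s : word X) :
  (forall u v, u \in s -> v \in s -> comm_near R M (h u.1) (h v.1)) ->
  (forall x, count_mem (x, false) s = count_mem (x, true) s) ->
  near R (M * size s ^ 2) (word_eval h s) 1.
Proof.
have [n] := ubnP (size s); elim: n s => [//|n IHn] [|u s] sn hs bal.
  by rewrite word_eval_nil; apply: nearxx.
have us : letter_inv u \in s.
  rewrite -has_pred1 has_count; case: u {hs sn} bal => x b /(_ x) /=.
  by rewrite /letter_inv; case: b => /=; rewrite !xpair_eqE !eqxx /=; lia.
case/splitPr: us sn hs bal => s1 s2 sn hs bal.
have sub12 v : v \in s1 ++ s2 -> v \in u :: s1 ++ letter_inv u :: s2.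
  by rewrite inE !mem_cat inE => /orP[] ->; rewrite !orbT.
have hs' v w : v \in s1 ++ s2 -> w \in s1 ++ s2 -> comm_near R M (h v.1) (h w.1).
  by move=> /sub12 vs /sub12 ws; apply: hs.
have /IHn -/(_ hs') : (size (s1 ++ s2) < n)%N.
  by move: sn; rewrite /= !size_cat /=; lia.
have bal' x : count_mem (x, false) (s1 ++ s2) = count_mem (x, true) (s1 ++ s2).
  have := bal x; rewrite /= !count_cat /=; case: (u) => y b; rewrite /letter_inv /=.
  by rewrite !xpair_eqE; case: (y == x); case: b => /=; lia.
move=> /(_ bal') near12.
apply: (@nearW _ _ (M * size s1 + M * size (s1 ++ s2) ^ 2)).
  by rewrite -mulnDr leq_mul2l /= !size_cat /=; apply/orP; right; nia.
apply: near_trans near12.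
rewrite word_eval_cons !word_eval_cat word_eval_cons letter_evalV mulgA.
rewrite [X in near _ _ _ X](_ : _ = word_eval h s1 * letter_eval h u *
  ((letter_eval h u)^-1 * word_eval h s2)); last by rewrite -mulgA mulVKg.
apply/nearMr/comm_near_word => v vs; apply: hs; rewrite inE.
  by rewrite mem_cat vs orbT.
by rewrite eqxx.
Qed.

End BalancedWords.

(** * Cost of commutation in a metabelian group *)

Section Metabelian.
Variable E : groupType.
Hypothesis metaE : forall x y z t : E, commute [~ x, y] [~ z, t].
Variable R : set E.

(** The conjugators differ by the factor [[~ z, t]], which commutes with every conjugate of
    [[~ x, y]] because such a conjugate is again a commutator. *)
Lemma comm_conj_swap (x y z t : E) : [~ x, y] ^ (z * t) = [~ x, y] ^ (t * z).
Proof.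
rewrite (commgC z t) [RHS]conjRg; set g := t * z.
by rewrite conjgM conjRg; apply/conjg_fixP/commgP/metaE.
Qed.

(** Conjugations by [u] and by [z] may be exchanged on a commutator, so the cost does not grow with
    [z]. The linear estimates below rest on this. *)
Lemma comm_near_comm_conj n (u x y z : E) :
  comm_near R n u [~ x, y] -> comm_near R n u ([~ x, y] ^ z).
Proof.
move=> /comm_near_sym/near_commute uc; apply/comm_near_sym/near_commute.
by rewrite -conjgM comm_conj_swap conjgM; apply: nearJ.
Qed.

Variables (m k : nat) (alpha : 'I_m -> E) (theta : 'I_k -> E) (c : nat).
Hypothesis alphaC : forall i j, comm_near R c (alpha i) (alpha j).
Hypothesis alpha_commC : forall i j p, comm_near R c (alpha i) [~ alpha j, theta p].

(** A commutator with a product of letters is a product of conjugates of commutators with single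
    letters, and the conjugators cost nothing. *)
Lemma comm_near_alpha_comm n i j u : length_le (range theta) n u ->
  comm_near R (c * n) (alpha i) [~ alpha j, u].
Proof.
move=> [s [ths <- sn]]; apply: (@comm_nearW _ _ (c * size s)); first by rewrite leq_mul2l sn orbT.
elim: s ths {sn} => [|v s IHs] ths.
  by rewrite big_nil commg1 /comm_near mulg1 mul1g; apply: nearxx.
rewrite big_cons mulnS addnC (_ : [~ _, _ * _] =
  [~ alpha j, \prod_(w <- s) w] * [~ alpha j, v] ^ (\prod_(w <- s) w)).
  apply: comm_nearM; first by apply: IHs => w ws; apply: ths; rewrite inE ws orbT.
  apply: comm_near_comm_conj.
  have [|[p _ <-]|[p _ pv]] := ths v; rewrite ?inE ?eqxx //.
  (* Here [v] is the inverse of [theta p]: its commutator with [alpha j] is a conjugate of the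
     inverse of [[~ alpha j, theta p]]. *)
  suff -> : [~ alpha j, v] = [~ theta p, alpha j] ^ v.
    by apply: comm_near_comm_conj; rewrite -invgR; apply: comm_nearV.
  by rewrite pv /commg /conjg !invgK !mulgA mulVg mul1g.
by rewrite /commg /conjg !invgM !mulgA !mulgK.
Qed.

(** Conjugating both sides by the inverse of [u] leaves a single conjugator [v * u^-1]. Then
    [alpha j ^ (v * u^-1)] is [alpha j] times a commutator: the first factor costs [c], the second
    [c * (n + p)]. *)
Lemma comm_near_alpha_conj n p i j u v :
  length_le (range theta) n u -> length_le (range theta) p v ->
  comm_near R (c * (n + p).+1) (alpha i ^ u) (alpha j ^ v).
Proof.
move=> un vp; rewrite -[alpha j ^ v](conjgKV u) -(conjgM _ v); apply: comm_nearJ.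
have uv : length_le (range theta) (n + p) (v * u^-1).
  by rewrite addnC; apply/length_leM/length_leV.
rewrite -[alpha j ^ _](mulVKg (alpha j)) -commgEl mulnS.
exact/comm_nearM/comm_near_alpha_comm.
Qed.

End Metabelian.

(** * Wreath products *)

Section WreathTheory.
Variables A T : groupType.
Local Notation W := (wreath A T).
Implicit Types (x y g : W) (u v : T).

Lemma wreath_eq x y : wreath_top x = wreath_top y ->
  (forall v, wreath_fun x v = wreath_fun y v) -> x = y.
Proof. by case: x y => [f u] [g v] /= -> /fsfunP ->. Qed.

Lemma wreath_topM : {morph @wreath_top A T : x y / x * y}.
Proof. by []. Qed.

Lemma wreath_funM x y v :
  wreath_fun (x * y) v = wreath_fun x v * wreath_fun y ((wreath_top x)^-1 * v).
Proof. by rewrite [LHS]base_mulE base_shiftE. Qed.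

Lemma wreath_funV x v : wreath_fun x^-1 v = (wreath_fun x (wreath_top x * v))^-1.
Proof. by rewrite [LHS]base_shiftE base_invE invgK. Qed.

Lemma wreath_fun1 v : wreath_fun (1 : W) v = 1.
Proof. exact: base_oneE. Qed.

Lemma wreath_inTM : {morph @wreath_inT A T : u v / u * v}.
Proof.
move=> u v; apply: wreath_eq => // w.
by rewrite wreath_funM /= !base_oneE mulg1.
Qed.

Lemma wreath_inAE (a : A) v : wreath_fun (wreath_inA T a) v = if v == 1 then a else 1.
Proof. by rewrite /= fsfun_withE base_oneE. Qed.

Lemma wreath_inAM : {morph @wreath_inA A T : a b / a * b}.
Proof.
move=> x y; apply: wreath_eq => [|v]; first by rewrite wreath_topM /= mulg1.
rewrite wreath_funM !wreath_inAE /= invg1 mul1g.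
by case: (v == 1); rewrite ?mulg1.
Qed.

Lemma base_group_top x : base_group A T x -> wreath_top x = 1.
Proof.
move=> Bx; apply: (Bx [set x | wreath_top x = 1]); split.
  exact: (is_normal_preim wreath_topM (is_normal_trivial T)).
by move=> _ [a _ <-].
Qed.

Hypothesis commA : forall x y : A, commute x y.

Lemma base_commute x y : wreath_top x = 1 -> wreath_top y = 1 -> commute x y.
Proof.
move=> x1 y1; apply: wreath_eq => [|v]; first by rewrite !wreath_topM x1 y1.
by rewrite !wreath_funM x1 y1 invg1 !mul1g; apply: commA.
Qed.

(** The values of [g] cancel because [A] is commutative, so on the base group conjugation is a mere
    translation of the index. *)
Lemma base_conj_fun x g v : wreath_top x = 1 ->
  wreath_fun (x ^ g) v = wreath_fun x (wreath_top g * v).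
Proof.
move=> x1; rewrite conjgE !wreath_funM wreath_funV x1 invg1 mul1g.
rewrite (morph_inv wreath_topM) invgK; set b := wreath_fun g _.
by rewrite commA -mulgA mulgV mulg1.
Qed.

Lemma base_conj_top x g : wreath_top x = 1 -> wreath_top (x ^ g) = 1.
Proof. by move=> x1; rewrite (morph_conj wreath_topM) x1 conj1g. Qed.

Lemma base_conj_inT x g : wreath_top x = 1 -> x ^ g = x ^ wreath_inT A (wreath_top g).
Proof.
by move=> x1; apply: wreath_eq => [|v]; rewrite ?base_conj_top // !base_conj_fun.
Qed.

Lemma base_conj_same x g h : wreath_top x = 1 -> wreath_top g = wreath_top h -> x ^ g = x ^ h.
Proof. by move=> x1 gh; rewrite base_conj_inT // gh -base_conj_inT. Qed.

Lemma wreath_split x :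
  exists2 b : W, wreath_top b = 1 & x = b * wreath_inT A (wreath_top x).
Proof.
exists (x * (wreath_inT A (wreath_top x))^-1); last by rewrite mulgVK.
by rewrite wreath_topM (morph_inv wreath_topM) /= mulgV.
Qed.

Lemma base_prod x : wreath_top x = 1 ->
  x = \prod_(u <- finsupp (wreath_fun x)) wreath_inA T (wreath_fun x u) ^ (wreath_inT A u)^-1.
Proof.
move=> x1; pose F u : W := wreath_inA T (wreath_fun x u) ^ (wreath_inT A u)^-1.
(* For the induction the list is arbitrary: the partial product over [s] is the restriction of [x]
   to [s]. *)
have FE s : uniq s -> wreath_top (\prod_(u <- s) F u) = 1 /\
    forall v, wreath_fun (\prod_(u <- s) F u) v = if v \in s then wreath_fun x v else 1.
  elim: s => [|u s IHs] /=.
    by rewrite big_nil; split=> // v; rewrite wreath_fun1.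
  move=> /andP[nus /IHs [top1 funE]].
  rewrite big_cons; split; first by rewrite wreath_topM top1 base_conj_top ?mulg1.
  move=> v; rewrite wreath_funM (base_conj_top _ (erefl : wreath_top (wreath_inA T _) = 1)).
  rewrite invg1 mul1g funE base_conj_fun // wreath_inAE (morph_inv wreath_topM) /=.
  rewrite inE -(inj_eq (mulgI u)) mulVKg mulg1.
  by case: eqVneq => [->|_]; rewrite ?(negbTE nus) ?mulg1 ?mul1g.
have [top1 funE] := FE _ (fset_uniq (finsupp (wreath_fun x))).
apply: wreath_eq => [|v]; first by rewrite x1 top1.
by rewrite funE; case: finsuppP.
Qed.

Hypothesis commT : forall u v : T, commute u v.

Lemma wreath_comm_top x y : wreath_top [~ x, y] = 1.
Proof. by rewrite (morph_comm wreath_topM); apply/eqP/commgP/commT. Qed.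

Lemma wreath_metabelian x y z t : commute [~ x, y] [~ z, t].
Proof. exact: (base_commute (wreath_comm_top _ _) (wreath_comm_top _ _)). Qed.

End WreathTheory.

Lemma generated_basis (m : nat) (A : groupType) (a : 'I_m -> A) :
  free_abelian_basis a -> forall x, generated (range a) x.
Proof.
move=> ha x; rewrite (coordE ha x).
exact: length_le_generated (length_le_prod_expgz _ _ _).
Qed.

Lemma generated_morph (K L : groupType) (phi : K -> L) (S : set K) (S' : set L) :
  {morph phi : x y / x * y} -> (forall s, S s -> generated S' (phi s)) ->
  forall x, generated S x -> generated S' (phi x).
Proof.
move=> phiM SS' x Sx; apply: (Sx (phi @^-1` generated S')); split=> //.
exact: (is_subgroup_preim phiM (generated_subgroup _)).
Qed.

(** * Words in the wreath product and their cubic area *)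

Section WreathWords.
Variables (m k : nat) (A T : groupType) (a : 'I_m -> A) (t : 'I_k -> T).
Hypotheses (ha : free_abelian_basis a) (ht : free_abelian_basis t).
Local Notation W := (wreath A T).
Let commA := ha.1.
Let commT := ht.1.

Definition wreath_gen (i : 'I_m + 'I_k) : W :=
  match i with inl i => wreath_inA T (a i) | inr j => wreath_inT A (t j) end.

Lemma wreath_generated x : generated (range wreath_gen) x.
Proof.
have [_ SM SV] := generated_subgroup (range wreath_gen).
have genT u : generated (range wreath_gen) (wreath_inT A u).
  apply: (generated_morph (@wreath_inTM A T)) (generated_basis ht u) => _ [j _ <-].
  by apply: sub_gen_smallest; exists (inr j).
have genA y : generated (range wreath_gen) (wreath_inA T y).
  apply: (generated_morph (@wreath_inAM A T)) (generated_basis ha y) => _ [j _ <-].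
  by apply: sub_gen_smallest; exists (inl j).
have [b b1 ->] := wreath_split x; apply: (SM) => //; rewrite (base_prod commA b1).
elim/big_rec: _ => [|u y _ Sy]; first by case: (generated_subgroup (range wreath_gen)).
by apply: (SM) Sy; rewrite conjgE invgK; do !apply: (SM) => //; apply: (SV).
Qed.

(* The pair [((i, u), b)] stands for the letter [a_i^{+1,-1}] read at position [u]
   of the walk in T described by the letters of T. *)
Fixpoint trace (u : T) (w : word ('I_m + 'I_k)) : word ('I_m * T) :=
  match w with
  | [::] => [::]
  | (inl i, b) :: w' => ((i, u), b) :: trace u w'
  | (inr j, b) :: w' => trace (u * letter_eval t (j, b)) w'
  end.

Fixpoint endpoint (u : T) (w : word ('I_m + 'I_k)) : T :=
  match w with
  | [::] => u
  | (inl i, b) :: w' => endpoint u w'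
  | (inr j, b) :: w' => endpoint (u * letter_eval t (j, b)) w'
  end.

Lemma size_trace u w : (size (trace u w) <= size w)%N.
Proof.
elim: w u => [//|[[i|j] b] w IHw] u /=; first by rewrite ltnS.
by apply: leq_trans (IHw _) _.
Qed.

Lemma trace_norm u w x : x \in trace u w ->
  (coord_norm ht x.1.2 <= coord_norm ht u + size w)%N.
Proof.
elim: w u => [//|[[i|j] b] w IHw] u /=.
  rewrite inE => /predU1P [->|/IHw xw]; first exact: leq_addr.
  by rewrite addnS; apply: leqW.
move=> /IHw xw; apply: leq_trans xw _; rewrite addnS -addSn leq_add2r.
exact: coord_norm_letter.
Qed.

Definition wreath_place (x : 'I_m * T) : W :=
  wreath_inA T (a x.1) ^ (wreath_inT A x.2)^-1.

(** The prefix [u] is pushed to the right through the word: a letter of T is absorbed into it, a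
    letter of A becomes a conjugate by the current position. *)
Lemma word_eval_trace u w :
  wreath_inT A u * word_eval wreath_gen w =
  word_eval wreath_place (trace u w) * wreath_inT A (endpoint u w).
Proof.
elim: w u => [|[[i|j] b] w IHw] u; first by rewrite !word_eval_nil mulg1 mul1g.
  rewrite /= !word_eval_cons -mulgA -IHw !mulgA; congr (_ * _).
  by case: b; rewrite /letter_eval /= /wreath_place -?conjVg -conjgCV.
rewrite /= -IHw word_eval_cons mulgA wreath_inTM; congr (_ * _ * _).
by case: b; rewrite /letter_eval //= (morph_inv (@wreath_inTM A T)).
Qed.

Lemma wreath_placeE x v : wreath_fun (wreath_place x) v = if v == x.2 then a x.1 else 1.
Proof.
rewrite base_conj_fun // wreath_inAE (morph_inv (@wreath_topM A T)) /=.
by rewrite -(inj_eq (mulgI x.2)) mulVKg mulg1.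
Qed.

Lemma wreath_place_count s : wreath_top (word_eval wreath_place s) = 1 /\
  forall i v, coord ha (wreath_fun (word_eval wreath_place s) v) i =
    (Posz (count_mem ((i, v), false) s) - Posz (count_mem ((i, v), true) s))%R.
Proof.
elim: s => [|[[j u] b] s [top1 IHs]].
  by rewrite word_eval_nil; split=> // i v; rewrite wreath_fun1 coord1.
have place1 : wreath_top (wreath_place (j, u)) = 1 by rewrite base_conj_top.
have letter1 : wreath_top (letter_eval wreath_place ((j, u), b)) = 1.
  case: b; last exact: place1.
  by rewrite [LHS](morph_inv (@wreath_topM A T)) place1 invg1.
rewrite word_eval_cons; split; first by rewrite wreath_topM top1 letter1 mulg1.
move=> i v; rewrite wreath_funM letter1 invg1 mul1g coordM IHs /= !xpair_eqE.
rewrite (_ : coord ha _ i = (if b then - Posz ((j == i) && (u == v))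
                              else Posz ((j == i) && (u == v)))%R); last first.
  have coord_place : coord ha (wreath_fun (wreath_place (j, u)) v) i = Posz ((j == i) && (u == v)).
    rewrite wreath_placeE (eq_sym v) (eq_sym j); case: (u == v);
      by rewrite ?andbT ?andbF ?coord_gen ?coord1.
  case: (b); last exact: coord_place.
  by rewrite [wreath_fun _ _]wreath_funV place1 mul1g coordV coord_place.
by case: (b); rewrite ?andbT ?andbF /=;
  move: (count_mem _ s) (count_mem _ s) (nat_of_bool (_ && _)) => p q r; lia.
Qed.

(** The coordinates of the base part are signed counts of places. When they vanish the trace is
    balanced in the sense of [balanced_near1]. *)
Lemma trivial_word w : word_eval wreath_gen w = 1 ->
  endpoint 1 w = 1 /\
  forall x, count_mem (x, false) (trace 1 w) = count_mem (x, true) (trace 1 w).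
Proof.
move=> w1; have := word_eval_trace 1 w; rewrite w1 mulg1.
have [top1 cnt] := wreath_place_count (trace 1 w) => ew.
have e1 : endpoint 1 w = 1.
  by have := congr1 (@wreath_top A T) ew; rewrite wreath_topM top1 mul1g.
split=> // -[i v]; have := cnt i v; move: ew; rewrite e1 -[wreath_inT A 1]/(1 : W) mulg1 => <-.
by rewrite wreath_fun1 coord1; move: (count_mem _ _) (count_mem _ _) => p q pq; lia.
Qed.

Section MetabelianWords.
Variables (E : groupType) (R : set E) (alpha : 'I_m -> E) (theta : 'I_k -> E) (c : nat).
Hypothesis metaE : forall x y z t : E, commute [~ x, y] [~ z, t].
Hypothesis alphaC : forall i j, comm_near R c (alpha i) (alpha j).
Hypothesis thetaC : forall i j, comm_near R c (theta i) (theta j).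
Hypothesis alpha_commC : forall i j p, comm_near R c (alpha i) [~ alpha j, theta p].

Definition lift_gen (i : 'I_m + 'I_k) : E :=
  match i with inl i => alpha i | inr j => theta j end.

Definition lift_place (x : 'I_m * T) : E := alpha x.1 ^ (basis_lift ht theta x.2)^-1.

(** This is the computation of [word_eval_trace] carried out in [E]. Only letters of T cost: after
    each one the normal form of the position is restored, and its norm stays at most
    [coord_norm ht u + size w]. *)
Lemma lift_trace u w :
  near R (size w * (c * (coord_norm ht u + size w)))
    (basis_lift ht theta u * word_eval lift_gen w)
    (word_eval lift_place (trace u w) * basis_lift ht theta (endpoint u w)).
Proof.
elim: w u => [|[[i|j] b] w IHw] u.
- by rewrite !word_eval_nil mulg1 mul1g; apply: nearxx.
- rewrite /= !word_eval_cons mulgA (_ : basis_lift ht theta u * _ =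
    letter_eval lift_place ((i, u), b) * basis_lift ht theta u); last first.
    by case: b; rewrite /letter_eval /= /lift_place -?conjVg -conjgCV.
  rewrite -!mulgA; apply/nearMl/nearW/IHw; nia.
- rewrite /= !word_eval_cons mulgA.
  have step := nearMr (word_eval lift_gen w) (basis_lift_letter ht thetaC u (j, b)).
  apply: nearW (near_trans step (IHw _)).
  have := coord_norm_letter ht u (j, b).
  move: (coord_norm ht _) (coord_norm ht _) (size w) => p q r pq; nia.
Qed.

(** The trace of a trivial word is balanced, and its places lie within [size w] of the identity. Any
    two of them commute at linear cost, and a quadratic number of exchanges gives the cube. *)
Theorem metabelian_area w : word_eval wreath_gen w = 1 ->
  area_le R (4 * c * size w ^ 3) (word_eval lift_gen w).
Proof.
move=> /trivial_word [e1 bal]; set n := size w.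
suff : near R (4 * c * n ^ 3) (word_eval lift_gen w) 1 by rewrite /near invg1 mulg1.
have := lift_trace 1 w; rewrite e1 basis_lift1 coord_norm1 mul1g mulg1 => near_trace.
have commP x y : x \in trace 1 w -> y \in trace 1 w ->
    comm_near R (c * (n + n).+1) (lift_place x.1) (lift_place y.1).
  move=> /trace_norm; rewrite coord_norm1 add0n => xn.
  move=> /trace_norm; rewrite coord_norm1 add0n => yn.
  by apply: comm_near_alpha_conj => //; apply: length_leV;
    apply: length_leW (length_le_basis_lift ht theta _).
apply: nearW (near_trans near_trace (balanced_near1 commP bal)).
have := size_trace 1 w; rewrite -/n => sn.
(* The first term pays for collecting the trace, the second for cancelling it. *)
apply: (@leq_trans (n * (c * (0 + n)) + c * (n + n).+1 * n ^ 2)).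
  by apply: leq_add => //; apply: leq_mul => //; rewrite leq_sqr.
rewrite add0n [X in _ <= X]mulnC (expnS n 2) -mulnn.
case: (n) => [|p]; first by rewrite !muln0.
have -> : (p.+1 * (c * p.+1) + c * (p.+1 + p.+1).+1 * (p.+1 * p.+1) =
           c * (p.+1 * p.+1) * (p.+1 + p.+1).+2)%N by lia.
rewrite (_ : p.+1 * (p.+1 * p.+1) * (4 * c) = c * (p.+1 * p.+1) * (4 * p.+1))%N; last by lia.
by rewrite leq_mul2l; apply/orP; right; lia.
Qed.

End MetabelianWords.
End WreathWords.

(** * Free metabelian groups and relative area *)

Section QuotientTheory.
Variables (K : groupType) (S : set K).

Lemma quotient_proj_morph : {morph @quotient_proj K S : x y / x * y}.
Proof. by move=> x y; rewrite -quotient_projM. Qed.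

Lemma quotient_proj1 x : quotient_proj S x = 1 <-> normal_closure S x.
Proof.
split=> [/esym/quotient_proj_eq|Nx]; first by rewrite invg1 mul1g.
by apply/esym/quotient_proj_eq; rewrite invg1 mul1g.
Qed.

Variables (L : groupType) (psi : K -> L).
Hypothesis psiM : {morph psi : x y / x * y}.
Hypothesis psi1 : forall s, S s -> psi s = 1.

Definition quotient_lift (q : quotient_by S) : L := psi (repr q).

Lemma quotient_lift_proj x : quotient_lift (quotient_proj S x) = psi x.
Proof.
have Nx := (quotient_proj_eq S _ _).1 (quotient_projK (quotient_proj S x)).
have : psi ((repr (quotient_proj S x))^-1 * x) = 1.
  apply: (Nx [set x | psi x = 1]); split; last exact: psi1.
  exact: (is_normal_preim psiM (is_normal_trivial L)).
by rewrite psiM (morph_inv psiM) => /mulg1_eq; rewrite invgK.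
Qed.

Lemma quotient_lift_morph : {morph quotient_lift : x y / x * y}.
Proof.
elim/quotient_projP => x; elim/quotient_projP => y.
by rewrite -quotient_proj_morph !quotient_lift_proj psiM.
Qed.

End QuotientTheory.

(** * Universal property of free metabelian groups *)

Section FreeMetabelianTheory.
Variable X : choiceType.
Local Notation F := (free_metabelian X).

Lemma free_gen_eval (w : word X) : free_class w = word_eval (@free_gen X) w.
Proof.
elim: w => [|[x b] w IHw]; first by rewrite word_eval_nil.
rewrite word_eval_cons -IHw -cat1s -free_classM; congr (_ * _).
by case: b => //; rewrite /letter_eval /= [RHS]free_classV.
Qed.

Lemma free_metabelian_word (x : F) : exists w, x = word_eval (@free_metabelian_gen X) w.
Proof.
elim/quotient_projP: x => x; elim/free_classP: x => w; exists w.
by rewrite free_gen_eval (morph_word_eval (@quotient_proj_morph _ _)).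
Qed.

Lemma free_metabelian_metabelian (x y z t : F) : commute [~ x, y] [~ z, t].
Proof.
elim/quotient_projP: x => x; elim/quotient_projP: y => y.
elim/quotient_projP: z => z; elim/quotient_projP: t => t.
have Dcomm (u v : free_group X) : derived_subgroup setT [~ u, v].
  by apply: sub_gen_smallest; exists u, v.
have DDcomm : derived_subgroup (derived_subgroup setT) [~ [~ x, y], [~ z, t]].
  by apply: sub_gen_smallest; exists [~ x, y], [~ z, t].
have qM := @quotient_proj_morph _ (derived_subgroup (derived_subgroup [set: free_group X])).
apply/commgP/eqP; rewrite -(morph_comm qM x) -(morph_comm qM z) -(morph_comm qM [~ x, y]).
exact: (quotient_proj1 _ _).2 (sub_gen_smallest DDcomm).
Qed.

Variables (L : groupType) (h : X -> L).
Hypothesis metaL : forall x y z t : L, commute [~ x, y] [~ z, t].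

Definition free_lift (x : free_group X) : L := word_eval h (repr x).

Lemma free_lift_class w : free_lift (free_class w) = word_eval h w.
Proof.
have eq_eval u v : Relation_Operators.clos_refl_sym_trans _ (@cancel_step X) u v ->
    word_eval h u = word_eval h v.
  elim=> {u v} [_ _ [u v c]|//|u v _ -> //|u v v' _ -> _ ->] //.
  by rewrite !word_eval_cat !word_eval_cons letter_evalV mulVKg.
by apply/eq_eval/free_class_eq/free_classK.
Qed.

Lemma free_lift_morph : {morph free_lift : x y / x * y}.
Proof.
elim/free_classP => v; elim/free_classP => w.
by rewrite [_ * _]free_classM !free_lift_class word_eval_cat.
Qed.

(** The lift to the free group must kill the second derived subgroup, so commutation of commutators
    in [L] has to be extended to the subgroups they generate. *)
Lemma free_metabelian_lift : exists2 phi : F -> L, {morph phi : x y / x * y} &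
  forall x, phi (free_metabelian_gen x) = h x.
Proof.
have lift1 s : derived_subgroup (derived_subgroup [set: free_group X]) s -> free_lift s = 1.
  (* Used twice, for the inner and for the outer derived subgroup. *)
  have comm_sub (M : set L) (H : set (free_group X)) (HM : set L) : is_subgroup M ->
      (forall x, H x -> HM (free_lift x)) ->
      (forall x y, HM x -> HM y -> M [~ x, y]) ->
      forall x, derived_subgroup H x -> M (free_lift x).
    move=> subM HHM commM x Hx; apply: (Hx (free_lift @^-1` M)); split.
      exact: (is_subgroup_preim free_lift_morph).
    move=> _ [y [z [Hy Hz ->]]]; rewrite /preimage /= (morph_comm free_lift_morph).
    by apply: commM; apply: HHM.
  have [triv _] := is_normal_trivial L.
  apply: (comm_sub [set 1] _ (derived_subgroup [set: L])) => //.
    apply: (comm_sub _ _ setT) => // [|x y _ _]; first exact: generated_subgroup.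
    by apply: sub_gen_smallest; exists x, y.
  (* Centralisers are subgroups, so commutation passes from commutators to the derived subgroup;
     applied once on each side of the product. *)
  have cent (H C : set L) : (forall x y, H x -> H y -> forall z, C z -> commute [~ x, y] z) ->
      forall x z, derived_subgroup H x -> C z -> commute x z.
    move=> HC x z Hx Cz; apply: (Hx [set x | commute x z]); split; last first.
      by move=> _ [u [v [Hu Hv ->]]]; apply: HC.
    split=> [|u v uz vz|u uz]; apply: commute_sym.
    - exact: commute1.
    - by apply: commuteM; apply: commute_sym.
    - by apply: commuteV; apply: commute_sym.
  move=> x y Hx Hy; apply/eqP/commgP.
  apply: (cent setT (derived_subgroup [set: L])) Hx Hy => u v _ _ z Hz.
  apply: commute_sym; apply: (cent setT [set [~ u, v]]) Hz _ => // u' v' _ _ _ ->.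
  exact: metaL.
exists (quotient_lift free_lift); first exact: quotient_lift_morph free_lift_morph lift1.
move=> x; rewrite (quotient_lift_proj free_lift_morph lift1) free_lift_class.
by rewrite /word_eval big_seq1.
Qed.

End FreeMetabelianTheory.

(** * The relative Dehn function *)

Section DehnFunction.
Variables (G : groupType) (P : relative_presentation G).
Local Notation F := (free_metabelian (gens P)).
Local Notation delta := (relative_dehn_function P).

Lemma pres_mapM : {morph pres_map P : x y / x * y}.
Proof. exact: gmulfM. Qed.

Lemma pres_map_near x y : pres_map P x = pres_map P y -> exists n, near [set` rels P] n x y.
Proof.
move=> xy; apply: normal_closure_area; rewrite -pres_map_ker /=.
by rewrite pres_mapM (morph_inv pres_mapM) xy mulgV.
Qed.

Lemma relative_areaP w l :
  (exists g r : 'I_l -> F, (forall i, r i \in rels P \/ (r i)^-1 \in rels P) /\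
     free_metabelian_eval w = \prod_(i < l) ((g i)^-1 * r i * g i)) <->
  (exists2 s : seq (F * F), size s = l &
    (forall u, u \in s -> u.1 \in rels P \/ u.1^-1 \in rels P) /\
     free_metabelian_eval w = \prod_(u <- s) u.1 ^ u.2).
Proof.
split=> [[g [r [rP ->]]]|[s <- [sP ->]]].
  exists [seq (r i, g i) | i <- index_enum 'I_l].
    by rewrite size_map -[RHS]card_ord cardT enumT.
  split; first by move=> _ /mapP[i _ ->]; apply: rP.
  by rewrite big_map; apply: eq_bigr => i _; rewrite conjgE mulgA.
exists (fun i => (tnth (in_tuple s) i).2), (fun i => (tnth (in_tuple s) i).1).
split; first by move=> i; apply: sP; exact: (mem_tnth i (in_tuple s)).
by rewrite big_tnth; apply: eq_bigr => i _; rewrite conjgE mulgA.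
Qed.

Lemma relative_area_le w n :
  area_le [set` rels P] n (free_metabelian_eval w) -> (relative_area w <= n)%N.
Proof.
move=> [s [sP ws sn]]; apply: leq_trans sn; apply: infimum_nat_le.
by apply/relative_areaP; exists s.
Qed.

Lemma area_le_relative_area w : pres_map P (free_metabelian_eval w) = 1 ->
  area_le [set` rels P] (relative_area w) (free_metabelian_eval w).
Proof.
move=> w1; have : normal_closure [set` rels P] (free_metabelian_eval w).
  by rewrite -pres_map_ker.
move=> /normal_closure_area [n [s [sP ws _]]].
have [|s' sz [s'P s'w]] := (relative_areaP w (relative_area w)).1.
  pose A := [set l | exists g r : 'I_l -> F, (forall i, r i \in rels P \/ (r i)^-1 \in rels P) /\
     free_metabelian_eval w = \prod_(i < l) ((g i)^-1 * r i * g i)].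
  by apply: (@infimum_nat_mem A (size s)); apply/relative_areaP; exists s.
by exists s'; split=> //; rewrite sz.
Qed.

Lemma dehn_function_ge w n : pres_map P (free_metabelian_eval w) = 1 ->
  (size w <= n)%N -> area_le [set` rels P] (delta n) (free_metabelian_eval w).
Proof.
move=> w1 wn; apply: area_leW (area_le_relative_area w1).
(* The finitely many words of length at most [n] bound the set of areas, so the supremum is not the
   default value. *)
pose b := (\max_(i < n.+1) \max_(s : i.-tuple (gens P * bool)) @relative_area G P s)%N.
apply: (@supremum_nat_ge _ _ b); last by exists w.
move=> _ [v [_ vn] <-]; rewrite /b.
apply: (bigmax_sup (Ordinal (vn : size v < n.+1)%N)) => //=.
exact: (bigmax_sup (in_tuple v)).
Qed.

Lemma dehn_function_le n b :
  (forall w, pres_map P (free_metabelian_eval w) = 1 -> (size w <= n)%N ->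
     area_le [set` rels P] b (free_metabelian_eval w)) ->
  (delta n <= b)%N.
Proof.
by move=> Pb; apply: supremum_nat_le => _ [w [w1 wn] <-]; apply/relative_area_le/Pb.
Qed.

Lemma dehn_function_mono m n : (m <= n)%N -> (delta m <= delta n)%N.
Proof.
by move=> mn; apply: dehn_function_le => w w1 wm; apply/dehn_function_ge/(leq_trans wm).
Qed.

End DehnFunction.

(** * The two comparisons *)

Section WreathQuotient.
Variables (m k l : nat) (A T : groupType) (a : 'I_m -> A) (t : 'I_k -> T).
Hypotheses (ha : free_abelian_basis a) (ht : free_abelian_basis t).
Local Notation W := (wreath A T).
Variables (f : 'I_l -> W).
Hypothesis hf : forall i, base_group A T (f i).
Let commA := ha.1.
Let commT := ht.1.
Local Notation N := (normal_closure (range f)).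
Local Notation pi := (quotient_proj (range f)).
Local Notation top := (@wreath_top A T).
Local Notation inT := (@wreath_inT A T).
Let topM := @wreath_topM A T.
Let piM := @quotient_proj_morph W (range f).

Definition sub_gen (i : 'I_l + 'I_k) : W :=
  match i with inl i => f i | inr j => inT (t j) end.

Lemma sub_gen_generated :
  generated (range sub_gen) = generated (range f `|` range (fun i => inT (t i))).
Proof.
apply/seteqP; split; apply: generated_gen => g.
  by move=> [[i|j] _ <-]; apply: sub_gen_smallest; [left; exists i | right; exists j].
by move=> [[i _ <-]|[j _ <-]]; apply: sub_gen_smallest; [exists (inl i) | exists (inr j)].
Qed.

Let f_top i : top (f i) = 1.
Proof. exact: base_group_top. Qed.

Lemma inT_generated u : generated (range sub_gen) (inT u).
Proof.
apply: (generated_morph (@wreath_inTM A T)) (generated_basis ht u) => _ [j _ <-].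
by apply: sub_gen_smallest; exists (inr j).
Qed.

(** A conjugate of a base element depends only on the top of the conjugator, so conjugation by
    elements of T suffices, and these lie in the subgroup generated by [sub_gen]. *)
Lemma ncl_top_generated x : N x -> top x = 1 /\ generated (range sub_gen) x.
Proof.
have [S1 SM SV] := generated_subgroup (range sub_gen).
move=> Nx; apply: (Nx [set x | top x = 1 /\ generated (range sub_gen) x]).
split=> [|_ [i _ <-]]; last by split; [apply: f_top | apply: sub_gen_smallest; exists (inl i)].
split=> [|y g [y1 Sy]]; first split=> [|y z [y1 Sy] [z1 Sz]|y [y1 Sy]].
- by split.
- by split; [rewrite topM y1 z1 mulg1 | apply: SM].
- by split; [rewrite (morph_inv topM) y1 invg1 | apply: SV].
- split; first exact: base_conj_top.
  rewrite (base_conj_inT commA) // conjgE.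
  exact: SM _ _ (SV _ (inT_generated _)) (SM _ _ Sy (inT_generated _)).
Qed.

Lemma ncl_top x : N x -> top x = 1.
Proof. by case/ncl_top_generated. Qed.

Lemma ncl_generated x : N x -> generated (range sub_gen) x.
Proof. by case/ncl_top_generated. Qed.

Lemma pi1 x : pi x = 1 <-> N x.
Proof. exact: quotient_proj1. Qed.

(** Both sides are homomorphisms that agree on the generators: each [f i] dies in the quotient and
    has trivial top. *)
Lemma sub_gen_proj x : generated (range sub_gen) x -> pi x = pi (inT (top x)).
Proof.
move=> /generated_length_le [n /length_le_word [v _ <-]].
rewrite (morph_word_eval piM).
have pitM : {morph (pi \o inT \o top) : x y / x * y}.
  by move=> y z; apply: etrans (congr1 pi (wreath_inTM _ _ _)) (piM _ _).
rewrite -[RHS]/((pi \o inT \o top) _) (morph_word_eval pitM); congr word_eval.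
apply: funext => -[i|j] //=; rewrite f_top -[inT 1]/(1 : W) (morph_one piM).
by apply/pi1; apply: sub_gen_smallest; exists i.
Qed.

(** With [ncl_top_generated], this identifies [N] with the elements of trivial top in the subgroup
    generated by [sub_gen]. *)
Lemma generated_ncl x : generated (range sub_gen) x -> top x = 1 -> N x.
Proof.
by move=> /sub_gen_proj pix x1; apply/pi1; rewrite pix x1 -[inT 1]/(1 : W) (morph_one piM).
Qed.

Variables (S Y : {fset W}).
Hypothesis genS : generated [set` S] = [set: W].
Hypothesis genY : generated [set` Y] = generated (range sub_gen).
Variable P : relative_presentation (quotient_by (range f)).
Local Notation F := (free_metabelian (gens P)).
Local Notation Delta := (distortion_function [set` S] (generated (range sub_gen)) [set` Y]).
Local Notation delta := (relative_dehn_function P).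
Local Notation near := (near [set` rels P]).
Let presM := @pres_mapM _ P.

Lemma Y_length : exists c, forall n g,
  length_le [set` Y] n g -> length_le (range sub_gen) (c * n) g.
Proof.
have [c cP] : exists c, forall g, g \in Y -> length_le (range sub_gen) c g.
  by apply: finite_length_bound => g gY; rewrite -genY; apply: sub_gen_smallest.
by exists c => n g; apply: length_le_trans.
Qed.

Lemma sub_gen_length : exists c, forall n g,
  length_le (range sub_gen) n g -> length_le [set` Y] (c * n) g.
Proof.
have [||c cP] := @uniform_bound _ (fun i n => length_le [set` Y] n (sub_gen i)).
- by move=> i p q; apply: length_leW.
- move=> i; apply: generated_length_le; rewrite genY.
  by apply: sub_gen_smallest; exists i.
- by exists c => n g; apply: length_le_trans => _ [i _ <-].
Qed.

Lemma wreath_gen_length : exists c, forall n g,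
  length_le (range (wreath_gen a t)) n g -> length_le [set` S] (c * n) g.
Proof.
have [||c cP] := @uniform_bound _ (fun i n => length_le [set` S] n (wreath_gen a t i)).
- by move=> i p q; apply: length_leW.
- by move=> i; apply: generated_length_le; rewrite genS.
- by exists c => n g; apply: length_le_trans => _ [i _ <-].
Qed.

Lemma wreath_word x : exists w, word_eval (wreath_gen a t) w = x.
Proof.
by have /generated_length_le [n /length_le_word [w _ <-]] := wreath_generated ha ht x; exists w.
Qed.

Lemma word_bound (I : finType) (X : Type) (w : I -> word X) :
  exists c, forall i, (size (w i) <= c)%N.
Proof.
by apply: (@uniform_bound I (fun i n => (size (w i) <= n)%N)) => [i p q pq /leq_trans|i];
  [apply | exists (size (w i))].
Qed.

Lemma near_bound (I : finType) (x y : I -> F) :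
  (forall i, pres_map P (x i) = pres_map P (y i)) -> exists c, forall i, near c (x i) (y i).
Proof.
move=> xy; apply: (@uniform_bound I (fun i n => near n (x i) (y i))).
  by move=> i p q; apply: nearW.
by move=> i; apply: pres_map_near.
Qed.

Theorem dehn_le_distortion : exists2 C : nat, (0 < C)%N &
  forall n, (delta n <= C * maxn n (Delta (C * n)) ^ 3)%N.
Proof.
have /choice [gE gEP] i : exists x : F, pres_map P x = pi (wreath_gen a t i).
  exact: pres_map_surj.
have /choice [wX wXP] (x : gens P) : exists w : word ('I_m + 'I_k),
    pi (word_eval (wreath_gen a t) w) = pres_map P (free_metabelian_gen x).
  have [w wx] := wreath_word (repr (pres_map P (free_metabelian_gen x))).
  by exists w; rewrite wx quotient_projK.
have pres_gE w : pres_map P (word_eval gE w) = pi (word_eval (wreath_gen a t) w).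
  by rewrite (morph_word_eval presM) (morph_word_eval piM); congr word_eval; apply: funext.
have /choice [fw fwP] i := wreath_word (f i).
(* [wH] spells the generators of the subgroup, [wT] erases the [f i]. The two spellings agree in the
   quotient, so in the free metabelian group they differ at a bounded cost [c5] per letter. *)
pose wH (i : 'I_l + 'I_k) := match i with inl i => fw i | inr j => [:: (inr j, false)] end.
pose wT (i : 'I_l + 'I_k) : word ('I_m + 'I_k) :=
  match i with inl i => [::] | inr j => [:: (inr j, false)] end.
have wHP i : word_eval (wreath_gen a t) (wH i) = sub_gen i.
  by case: i => [i|j]; [apply: fwP | rewrite /word_eval big_seq1].
have wTP i : word_eval (wreath_gen a t) (wT i) = inT (top (sub_gen i)).
  by case: i => [i|j] /=; [rewrite f_top word_eval_nil | rewrite /word_eval big_seq1].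
have base_comm x y : top x = 1 -> top y = 1 -> pi x * pi y = pi y * pi x.
  by move=> x1 y1; rewrite -!piM (base_commute commA).
(* The constants [c1], [c2] and [c3] supply the three commutation hypotheses of [metabelian_area]:
   these relations hold in the wreath product, hence in the quotient. *)
have [|c1 c1P] := @near_bound _ (fun u => gE (inl u.1) * gE (inl u.2))
    (fun u => gE (inl u.2) * gE (inl u.1)).
  by move=> u; rewrite !presM !gEP base_comm.
have [|c2 c2P] := @near_bound _ (fun u => gE (inr u.1) * gE (inr u.2))
    (fun u => gE (inr u.2) * gE (inr u.1)).
  by move=> u; rewrite !presM !gEP -!piM /= -!wreath_inTM commT.
have [|c3 c3P] := @near_bound _
    (fun u => gE (inl u.1.1) * [~ gE (inl u.1.2), gE (inr u.2)])
    (fun u => [~ gE (inl u.1.2), gE (inr u.2)] * gE (inl u.1.1)).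
  move=> [[i i'] j] /=; set x := gE (inl i); set y := [~ _, _].
  have yE : pres_map P y = pi [~ wreath_gen a t (inl i'), wreath_gen a t (inr j)].
    by rewrite (morph_comm presM) !gEP -(morph_comm piM).
  rewrite (presM x) (presM y) yE gEP base_comm //.
  exact: wreath_comm_top.
have [|c4 c4P] := @near_bound _ (@free_metabelian_gen (gens P)) (word_eval gE \o wX).
  by move=> x; rewrite /= pres_gE wXP.
have [|c5 c5P] := @near_bound _ (word_eval gE \o wH) (word_eval gE \o wT).
  move=> i; rewrite /= !pres_gE wHP wTP; apply: sub_gen_proj.
  by apply: sub_gen_smallest; exists i.
have [cX cXP] := word_bound wX.
have [cH cHP] := word_bound wH.
have cTP i : (size (wT i) <= 1)%N by case: i.
have [cS cSP] := wreath_gen_length.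
have [cY cYP] := Y_length.
pose c := (c1 + c2 + c3)%N.
have area0 w : word_eval (wreath_gen a t) w = 1 ->
    area_le [set` rels P] (4 * c * size w ^ 3) (word_eval gE w).
  rewrite (_ : gE = lift_gen (gE \o inl) (gE \o inr)); last by apply: funext => -[].
  apply: (metabelian_area ha ht) => *; first exact: free_metabelian_metabelian.
  - by apply: nearW (c1P (_, _)); rewrite /c; lia.
  - by apply: nearW (c2P (_, _)); rewrite /c; lia.
  - by apply: nearW (c3P (_, _, _)); rewrite /c; lia.
move: (4 * c)%N area0 => {}c area0.
(* The summands pay in turn for rewriting [w] as [w'], for comparing [w'] with [v'], for erasing the
   [f i] and for filling the remaining word [v0]. *)
pose K := (c4 + c * (cX + cH * cY) ^ 3 + (c5 * cY + c * cY ^ 3))%N.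
exists (K + cS * cX + 1)%N; first by rewrite addn1.
move=> n; apply: dehn_function_le => w w1 wn.
pose w' := subst_word wX w; pose h := word_eval (wreath_gen a t) w'.
have near_w' : near (c4 * size w) (free_metabelian_eval w) (word_eval gE w').
  by rewrite word_eval_subst; apply: word_eval_near.
have Nh : N h.
  apply/pi1; rewrite -pres_gE word_eval_subst (morph_word_eval presM) -[RHS]w1.
  rewrite [RHS](morph_word_eval presM); congr word_eval.
  by apply: funext => x /=; rewrite pres_gE wXP.
have w'n : (size w' <= cX * n)%N.
  by apply: leq_trans (size_subst w cXP) _; rewrite leq_mul2l wn orbT.
have hS : length_le [set` S] (cS * (cX * n)) h.
  apply: cSP; apply: (@length_leW _ _ (1 * size w')); first by rewrite mul1n.
  by apply: word_eval_length => i; apply: length_le_gen; exists i.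
set d := Delta (cS * (cX * n)).
have : length_le [set` Y] d h.
  apply: length_leW (distortion_ge _ genS (ncl_generated Nh) hS) _.
  by apply: length_le_word_length; rewrite genY; apply: ncl_generated.
move=> /cYP/length_le_word [v vd vh].
(* The words [w'] and [v'] have the same value [h] in the wreath product, while [v0] has value 1.
   Thus [area0] applies both to [w'] followed by the inverse of [v'] and to [v0]. *)
pose v' := subst_word wH v; pose v0 := subst_word wT v.
have v'E : word_eval (wreath_gen a t) v' = h.
  by rewrite word_eval_subst -vh; congr word_eval; apply: funext.
have v0E : word_eval (wreath_gen a t) v0 = 1.
  have tM : {morph (inT \o top) : x y / x * y} by move=> x y; apply: wreath_inTM.
  rewrite -[RHS]/(inT 1) -(ncl_top Nh) -vh -[RHS]/((inT \o top) _) (morph_word_eval tM).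
  by rewrite word_eval_subst; congr word_eval; apply: funext.
have near_v : near (c5 * size v) (word_eval gE v') (word_eval gE v0).
  by rewrite !word_eval_subst; apply: word_eval_near.
have area1 : area_le [set` rels P] (c * (cX * n + cH * (cY * d)) ^ 3)
    (word_eval gE w' / word_eval gE v').
  rewrite -word_eval_inv -word_eval_cat; apply: area_leW (area0 _ _).
    rewrite leq_mul2l leq_exp2r // size_cat size_word_inv leq_add ?orbT //.
    by apply: leq_trans (size_subst v cHP) _; rewrite leq_mul2l vd orbT.
  by rewrite word_eval_cat word_eval_inv v'E mulgV.
have area2 := area0 _ v0E.
have v0n : (size v0 <= cY * d)%N by have := size_subst v cTP; rewrite mul1n => /leq_trans->.
have near_v0 : near (c * size v0 ^ 3) (word_eval gE v0) 1.
  by rewrite /near invg1 mulg1.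
have := near_trans near_w' (near_trans area1 (near_trans near_v near_v0)).
rewrite {1}/near invg1 mulg1; apply: area_leW.
set M := maxn n _.
have nM : (n <= M)%N by apply: leq_maxl.
have dM : (d <= M)%N.
  apply: leq_trans (leq_maxr _ _); apply: distortion_mono => //.
  by rewrite mulnA leq_mul2r; apply/orP; right; lia.
have MM3 : (M <= M ^ 3)%N by case: (M) => // p; rewrite expnS leq_pmulr // expn_gt0.
clearbody M d.
apply: (@leq_trans (K * M ^ 3)); last by rewrite leq_mul2r -addnA leq_addr orbT.
rewrite /K !mulnDl -!addnA; apply: leq_add; first by apply: leq_mul => //; lia.
apply: leq_add.
  rewrite -mulnA -expnMn leq_mul2l leq_exp2r // mulnDl leq_add ?orbT //.
    by rewrite leq_mul2l nM orbT.
  by rewrite mulnA leq_mul2l dM orbT.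
have {}vd : (size v <= cY * M)%N by apply: leq_trans vd _; rewrite leq_mul2l dM orbT.
have {}v0n : (size v0 <= cY * M)%N by apply: leq_trans v0n _; rewrite leq_mul2l dM orbT.
apply: leq_add.
  rewrite -mulnA; apply: leq_mul => //; apply: leq_trans vd _.
  by rewrite leq_mul2l MM3 orbT.
by rewrite -mulnA -expnMn leq_mul2l leq_exp2r ?v0n ?orbT.
Qed.

(** * Detours inserted into a walk *)

Section Insertion.
Implicit Types (v : word ('I_l + 'I_k)) (u p : T) (x g r d : W).

(** These are the points of T met by the walk of [v] from 1. The target is translated back at each
    letter, so that no current position has to be carried along. *)
Fixpoint visits v u : Prop :=
  u = 1 \/ if v is c :: v' then visits v' ((top (letter_eval sub_gen c))^-1 * u) else False.

Lemma visits1 v : visits v 1.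
Proof. by case: v => [|c v]; left. Qed.

Lemma visits_cat v v' u :
  visits (v ++ v') u <-> visits v u \/ visits v' ((top (word_eval sub_gen v))^-1 * u).
Proof.
elim: v u => [|c v IHv] u /=.
  rewrite word_eval_nil (morph_one topM) invg1 mul1g; split; first by right.
  by move=> [[->|//]|//]; apply: visits1.
by rewrite word_eval_cons topM invgM -mulgA IHv; tauto.
Qed.

Lemma visits_split v u : visits v u ->
  exists v1 v2, v = v1 ++ v2 /\ top (word_eval sub_gen v1) = u.
Proof.
elim: v u => [|c v IHv] u /= [->|] //.
- by exists [::], [::]; rewrite word_eval_nil.
- by exists [::], (c :: v); rewrite word_eval_nil.
move=> /IHv [v1 [v2 [-> v1u]]]; exists (c :: v1), v2; split=> //.
by rewrite word_eval_cons topM v1u mulVKg.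
Qed.

Lemma base_fun_prod (s : seq (W * W)) u :
  (forall z, z \in s -> top z.1 = 1) ->
  wreath_fun (\prod_(z <- s) z.1 ^ z.2) u != 1 ->
  exists2 z, z \in s & wreath_fun z.1 (top z.2 * u) != 1.
Proof.
elim: s => [|z s IHs] s1; first by rewrite big_nil wreath_fun1 eqxx.
have z1 : top z.1 = 1 by apply: s1; rewrite inE eqxx.
rewrite big_cons wreath_funM base_conj_top // invg1 mul1g (base_conj_fun commA) //.
case: (eqVneq (wreath_fun z.1 (top z.2 * u)) 1) => [->|zu _]; last by exists z; rewrite ?inE ?eqxx.
rewrite mul1g => /IHs [|z' z's z'u]; last by exists z'; rewrite // inE z's orbT.
by move=> z' z's; apply: s1; rewrite inE z's orbT.
Qed.

Lemma base_prod_top (s : seq (W * W)) :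
  (forall z, z \in s -> top z.1 = 1) -> top (\prod_(z <- s) z.1 ^ z.2) = 1.
Proof.
move=> s1; rewrite (morph_prod topM) big1_seq // => z /andP[_ zs].
by rewrite base_conj_top // s1.
Qed.

Variables (D : seq T) (cD cR : nat) (R : W -> Prop).
Hypothesis D_length : forall p q, p \in D -> q \in D ->
  length_le (range sub_gen) cD (inT (p / q)).
Hypothesis R_top : forall r, R r -> top r = 1.
Hypothesis R_supp : forall r u, R r -> wreath_fun r u != 1 -> u \in D.
Hypothesis R_length : forall r, R r -> length_le (range sub_gen) cR r.

(* If some translate in [s] has its support close to the walk [v], a detour of
   bounded length along [v] accounts for it; if none has, then the support of
   [d] is disjoint from those of the translates, so [d] is trivial. *)
Lemma insert_detours (s : seq (W * W)) v :
  (forall z, z \in s -> R z.1) ->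
  (forall u, wreath_fun (\prod_(z <- s) z.1 ^ z.2) u != 1 ->
     exists2 p, visits v p & p^-1 * u \in D) ->
  length_le (range sub_gen) (size v + (2 * cD + cR) * size s)
    (\prod_(z <- s) z.1 ^ z.2 * word_eval sub_gen v).
Proof.
have [n] := ubnP (size s); elim: n s v => // n IHn s v sn sR supp.
have s1 z : z \in s -> top z.1 = 1 by move=> /sR/R_top.
have [[z zs [p vp [x xD [y yD pxy]]]]|far] := pselect (exists2 z, z \in s &
    exists2 p, visits v p & exists2 x, x \in D & exists2 y, y \in D & p * x = (top z.2)^-1 * y);
  last first.
  suff -> : \prod_(z <- s) z.1 ^ z.2 = 1.
    rewrite mul1g; apply: (@length_leW _ _ (1 * size v)); first by rewrite mul1n leq_addr.
    by apply: word_eval_length => i; apply: length_le_gen; exists i.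
  apply: wreath_eq => [|u]; first exact: base_prod_top.
  rewrite wreath_fun1; apply/eqP; apply: contraT => du; case: far.
  have [z zs zu] := base_fun_prod s1 du; have [p vp pD] := supp _ du.
  exists z => //; exists p => //; exists (p^-1 * u) => //; exists (top z.2 * u).
    exact: R_supp (sR _ zs) zu.
  by rewrite mulVKg mulKg.
have [v1 [v2 [ev v1p]]] := visits_split vp.
have /length_le_word [w wn wE] := D_length xD yD.
have /length_le_word [w' w'n w'E] := R_length (sR _ zs).
(* The detour leaves the walk at [p], goes to [p * (x / y)], which is the inverse of [top z.2],
   spells [z.1] there and returns. *)
pose v' := v1 ++ w ++ w' ++ word_inv w ++ v2.
case/splitPr: zs sn sR supp s1 => s1 s2 sn sR supp s_top.
have z1 : top z.1 = 1 by apply: s_top; rewrite mem_cat inE eqxx orbT.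
have sub12 z' : z' \in s1 ++ s2 -> z' \in s1 ++ z :: s2.
  by rewrite !mem_cat inE => /orP[] ->; rewrite ?orbT.
have top12 (s0 : seq (W * W)) : {subset s0 <= s1 ++ s2} -> top (\prod_(z <- s0) z.1 ^ z.2) = 1.
  by move=> s012; apply: base_prod_top => z' /s012/sub12/s_top.
have prod12 : \prod_(z <- s1 ++ z :: s2) z.1 ^ z.2 =
    z.1 ^ z.2 * \prod_(z <- s1 ++ s2) z.1 ^ z.2.
  rewrite !big_cat big_cons /= mulgA [RHS]mulgA; congr (_ * _).
  apply: (base_commute commA); last exact: base_conj_top.
  by apply: top12 => z' z's; rewrite mem_cat z's.
have topw : top (word_eval sub_gen w) = x / y by rewrite wE.
have topw' : top (word_eval sub_gen w') = 1 by rewrite w'E.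
have v'E : word_eval sub_gen v' = z.1 ^ z.2 * word_eval sub_gen v.
  rewrite (base_conj_same commA (h := (word_eval sub_gen v1 * word_eval sub_gen w)^-1)) //.
    rewrite ev !word_eval_cat word_eval_inv w'E conjgE invgK invgM !mulgA.
    by rewrite -(mulgA _ _ (word_eval sub_gen v1)) mulVg mulg1.
  by rewrite (morph_inv topM) topM topw v1p mulgA pxy mulgK invgK.
have sz : (size (s1 ++ s2)).+1 = size (s1 ++ z :: s2) by rewrite !size_cat /= addnS.
have {}IHn := IHn (s1 ++ s2) v' _ (fun z' z's => sR _ (sub12 _ z's)).
rewrite prod12 [_ ^ _ * _](base_commute commA) ?base_conj_top ?top12 // -mulgA -v'E.
apply: length_leW (IHn _ _).
- rewrite -sz mulnS addnA leq_add2r /v' ev !size_cat size_word_inv.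
  by move: wn w'n; move: (size w) (size w') => p1 p2 p1D p2R; lia.
- by rewrite sz -ltnS.
move=> u du.
have visitsW q : visits v q -> visits v' q.
  rewrite ev visits_cat => -[v1q|v2q]; rewrite visits_cat; first by left.
  right; rewrite !catA visits_cat; right; rewrite -!catA !word_eval_cat word_eval_inv.
  by rewrite !topM (morph_inv topM) topw' mul1g mulgV invg1 mul1g.
(* A point in the support of the removed translate is close to the tip of the detour; any other
   point is in the support of the original product, hence close to the old walk. *)
have [zu|zu] := eqVneq (wreath_fun (z.1 ^ z.2) u) 1; last first.
  exists (top z.2)^-1; last first.
    apply: (R_supp (sR z _)); first by rewrite mem_cat inE eqxx orbT.
    by rewrite invgK -(base_conj_fun commA).
  rewrite visits_cat; right; rewrite visits_cat; right; rewrite v1p topw.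
  suff -> : (x / y)^-1 * (p^-1 * (top z.2)^-1) = 1 by apply: visits1.
  have -> : (top z.2)^-1 = p * (x / y) by rewrite mulgA pxy mulgK.
  by rewrite mulKg mulVg.
have [|q vq qD] := supp u; last by exists q => //; apply: visitsW.
by rewrite prod12 wreath_funM zu mul1g base_conj_top // invg1 mul1g.
Qed.

End Insertion.

Lemma sub_gen_word u : exists w, word_eval sub_gen w = inT u.
Proof. by have /generated_length_le [n /length_le_word [w _ wu]] := inT_generated u; exists w. Qed.

Lemma finite_supports (s : seq W) : exists D : seq T,
  forall x u, x \in s -> wreath_fun x u != 1 -> u \in D.
Proof.
exists (flatten [seq finsupp (wreath_fun x) : seq T | x <- s]) => x u xs xu.
by apply/flatten_mapP; exists x; rewrite // mem_finsupp.
Qed.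

(** * Relations of the quotient evaluated in the wreath product *)

Section Lift.
Variable phi : F -> W.
Hypothesis phiM : {morph phi : x y / x * y}.
Hypothesis phiP : forall x, pi (phi x) = pres_map P x.

Lemma relator_image r : r \in rels P \/ r^-1 \in rels P -> N (phi r).
Proof.
have relN q : q \in rels P -> N (phi q).
  move=> qP; apply/pi1; rewrite phiP.
  by have: normal_closure [set` rels P] q by [apply: sub_gen_smallest]; rewrite -pres_map_ker.
case=> /relN //; rewrite (morph_inv phiM).
by have [[_ _ NV] _] := normal_closure_normal (range f) => /NV; rewrite invgK.
Qed.

(** A relation of bounded area yields a product of translates to which [insert_detours] applies
    along the walk of [w]. The detours account for the term in [delta n], the walk for the term in
    [n]. *)
Lemma relation_length : exists C : nat, forall n w,
  pres_map P (free_metabelian_eval w) = 1 -> (size w <= n)%N ->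
  length_le (range sub_gen) (C * (delta n + n)) (phi (free_metabelian_eval w)).
Proof.
pose gX (x : gens P) := phi (free_metabelian_gen x).
pose rs := [seq phi r | r <- (rels P : seq F) ++ map inv (rels P)].
pose R := [set x | x \in rs].
have R_ncl x : R x -> N x.
  move=> /mapP[r]; rewrite mem_cat => rP ->; apply: relator_image.
  by case/orP: rP => [|/mapP[q qP ->]]; rewrite ?invgK; [left | right].
(* [D] must contain the supports of the relators, for the detours, and those of the lifted
   generators and their inverses, for the support of the whole word. *)
have [D DP] := finite_supports (rs ++ [seq gX x | x <- enum (gens P)]
  ++ [seq (gX x)^-1 | x <- enum (gens P)]).
have [|cD cDP] := @finite_length_bound _ [seq inT (p / q) | p <- D, q <- D] (range sub_gen).
  by move=> _ /allpairsP[pq [_ _ ->]]; apply: inT_generated.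
have [|cR cRP] := @finite_length_bound _ rs (range sub_gen).
  by move=> x /R_ncl /ncl_generated.
have /choice [walk walkP] x := sub_gen_word (top (gX x)).
have [cW cWP] := word_bound walk.
exists (cW + (2 * cD + cR))%N => n w w1 wn; pose v := subst_word walk w.
have itM : {morph inT \o top : x y / x * y} by move=> x y; apply: wreath_inTM.
have phiw : phi (free_metabelian_eval w) = word_eval gX w by rewrite (morph_word_eval phiM).
have v_walk u : word_eval sub_gen (subst_word walk u) = inT (top (word_eval gX u)).
  rewrite word_eval_subst -[RHS]/((inT \o top) _) (morph_word_eval itM).
  by congr word_eval; apply: funext.
have top1 : top (phi (free_metabelian_eval w)) = 1.
  by apply: ncl_top; apply/pi1; rewrite phiP.
have [s [sP sw sn]] := dehn_function_ge w1 wn.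
pose s' := [seq (phi z.1, phi z.2) | z <- s].
have s'E : phi (free_metabelian_eval w) = \prod_(z <- s') z.1 ^ z.2.
  rewrite sw (morph_prod phiM) big_map.
  by apply: eq_bigr => z _; rewrite (morph_conj phiM).
have s'R z : z \in s' -> R z.1.
  move=> /mapP[z' /sP zP ->]; apply: map_f; rewrite mem_cat.
  case: zP => [->//|zP]; apply/orP; right; apply/mapP; exists z'.1^-1; rewrite ?invgK //.
(* Reading a letter changes the base part only near the current position, so the support of the
   value stays close to the walk. *)
have v_visits u q : wreath_fun (word_eval gX u) q != 1 ->
    exists2 p, visits (subst_word walk u) p & p^-1 * q \in D.
  elim: u q => [|[x b] u IHu] q; first by rewrite word_eval_nil wreath_fun1 eqxx.
  rewrite word_eval_cons wreath_funM.
  have [->|xq _] := eqVneq (wreath_fun (letter_eval gX (x, b)) q) 1; last first.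
    exists 1; first exact: visits1.
    rewrite invg1 mul1g; apply: DP xq; rewrite !mem_cat.
    by apply/orP; right; apply/orP; case: b; [right | left]; apply/mapP;
      exists x; rewrite ?mem_enum.
  rewrite mul1g => /IHu [p vp pD]; exists (top (letter_eval gX (x, b)) * p); last first.
    by rewrite invgM -mulgA.
  rewrite /subst_word /= visits_cat; right; rewrite -/(subst_word walk u).
  suff -> : word_eval sub_gen (subst_letter walk (x, b)) = inT (top (letter_eval gX (x, b))).
    by rewrite mulKg.
  have := v_walk [:: (x, b)]; rewrite /subst_word /= cats0 => ->.
  by rewrite /word_eval big_seq1.
have := @insert_detours D cD cR R _ _ _ _ s' v s'R _.
(* The walk is closed, so its own value is 1 and the product of the translates alone is bounded. *)
rewrite -s'E /v v_walk -phiw top1 -[inT 1]/(1 : W) mulg1 => len.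
apply: length_leW (len _ _ _ _ _).
- rewrite [X in (_ <= X)%N]mulnDl; apply: leq_add; last first.
    by rewrite leq_mul2l size_map (leq_trans sn) ?orbT // leq_addr.
  apply: leq_trans (size_subst w cWP) _.
  by rewrite leq_mul2l (leq_trans wn) ?orbT // leq_addl.
- by move=> p q pD qD; apply: cDP; apply/allpairsP; exists (p, q).
- by move=> r /R_ncl/ncl_top.
- by move=> r u rR; apply: DP; rewrite mem_cat [r \in rs]rR.
- exact: cRP.
- by move=> u; rewrite phiw; apply: v_visits.
Qed.

End Lift.

(** The wreath product is metabelian, as [A] and [T] are abelian; hence the images of the generators
    may be lifted arbitrarily. *)
Lemma presentation_lift : exists2 phi : F -> W, {morph phi : x y / x * y} &
  forall x, pi (phi x) = pres_map P x.
Proof.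
have [phi phiM phi_gen] := @free_metabelian_lift (gens P) W
  (fun x => repr (pres_map P (free_metabelian_gen x))) (wreath_metabelian commA commT).
exists phi => // x; have [w ->] := free_metabelian_word x.
rewrite (morph_word_eval phiM) (morph_word_eval presM) (morph_word_eval piM).
by congr word_eval; apply: funext => y /=; rewrite phi_gen quotient_projK.
Qed.

Theorem distortion_le_dehn : exists2 C : nat, (0 < C)%N &
  forall n, (Delta n <= C * (delta (C * n) + n))%N.
Proof.
have [phi phiM phiP] := presentation_lift.
have [C1 C1P] := relation_length phiM phiP.
have /choice [psi psiP] (g : W) : exists w : word (gens P),
    pres_map P (free_metabelian_eval w) = pi g.
  have [x xg] := pres_map_surj P (pi g); have [w xw] := free_metabelian_word x.
  by exists w; rewrite /free_metabelian_eval -xw.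
(* [nu g] measures how far [phi] is from returning [g]. Only finitely many letters [g] occur, so
   these corrections have bounded length. *)
pose nu g := g^-1 * phi (free_metabelian_eval (psi g)).
have nuN g : N (nu g).
  by apply/pi1; rewrite piM phiP psiP (morph_inv piM) mulVg.
pose Ls := (S : seq W) ++ map inv S.
have [|cL cLP] := @finite_length_bound _ [seq inT (top g) * nu g | g <- Ls] (range sub_gen).
  have [_ SM _] := generated_subgroup (range sub_gen).
  by move=> _ /mapP[g _ ->]; apply: SM _ _ (inT_generated _) (ncl_generated (nuN g)).
have [|cT cTP] := @finite_length_bound _ [seq inT (top g) | g <- Ls] (range sub_gen).
  by move=> _ /mapP[g _ ->]; apply: inT_generated.
have [cW cWP] : exists c, forall g, g \in Ls -> (size (psi g) <= c)%N.
  apply: (@uniform_bound_seq _ Ls (fun g n => (size (psi g) <= n)%N)) => [g p q pq /leq_trans|g _].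
    exact.
  by exists (size (psi g)).
have [cY cYP] := sub_gen_length.
have [|cS cSP] := @finite_length_bound _ [seq inT (top g) | g <- Ls] [set` S].
  by move=> g _; rewrite genS.
(* Removing the top part of an element costs [cS] per letter in addition to the letter itself, hence
   the factor [q]. *)
pose q := cS.+1; pose C2 := (cL * q + C1 * (1 + cW * q) + cT)%N.
exists (cY * C2 + cW * q + 1)%N; first by rewrite addn1.
move=> n; apply: distortion_le => // h Hh [s [sS hs sn]].
have in_Ls (s0 : seq W) : (forall u, u \in s0 -> [set` S] u \/ [set` S] u^-1) ->
    forall g, g \in s0 -> g \in Ls.
  move=> s0S g /s0S gS; rewrite mem_cat; apply/orP.
  by case: gS => gS; [left | right; apply/mapP; exists g^-1; rewrite ?invgK].
have itM : {morph inT \o top : x y / x * y} by move=> x y; apply: wreath_inTM.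
have inT_h : inT (top h) = \prod_(g <- s) inT (top g).
  by rewrite -hs -[LHS]/((inT \o top) _) (morph_prod itM).
have Th : length_le (range sub_gen) (cT * size s) (inT (top h)).
  by rewrite inT_h; apply: length_le_prod => g /(in_Ls _ sS) gL; apply/cTP/map_f.
have [s0 [s0S h0s s0n]] : length_le [set` S] (q * n) (h * (inT (top h))^-1).
  rewrite mulSn; apply: length_leM; first by exists s.
  apply: length_leV; rewrite inT_h.
  apply: (@length_leW _ _ (cS * size s)); first by rewrite leq_mul2l sn orbT.
  by apply: length_le_prod => g /(in_Ls _ sS) gL; apply/cSP/map_f.
have Nh0 : N (h * (inT (top h))^-1).
  have [_ SM SV] := generated_subgroup (range sub_gen).
  apply: generated_ncl; first exact: SM _ _ Hh (SV _ (inT_generated _)).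
  by rewrite topM (morph_inv topM) mulgV.
pose w0 := flatten [seq psi g | g <- s0].
have w0n : (size w0 <= cW * (q * n))%N.
  apply: (@leq_trans (cW * size s0)); last by rewrite leq_mul2l s0n orbT.
  have := in_Ls _ s0S; rewrite /w0; elim: (s0) => [//|g s1 IHs] sL /=.
  rewrite size_cat mulnS leq_add ?cWP ?sL ?mem_head ?IHs // => g' gs.
  by apply: sL; rewrite inE gs orbT.
have w0E : free_metabelian_eval w0 = \prod_(g <- s0) free_metabelian_eval (psi g).
  by rewrite /free_metabelian_eval /word_eval big_flatten /= big_map.
have w01 : pres_map P (free_metabelian_eval w0) = 1.
  rewrite w0E (morph_prod presM) (eq_bigr (fun g => pi g)); last by move=> g _; apply: psiP.
  by rewrite -(morph_prod piM) h0s; apply/pi1.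
(* [phi] of the word attached to [s1] is the product of [s1] with elements
   [nu g] of N inserted along the way; as the base group is abelian, these can
   be collected along the walk of [s1] in T at a linear cost in H. *)
have diff (s1 : seq W) : (forall g, g \in s1 -> g \in Ls) ->
    let u := \prod_(g <- s1) phi (free_metabelian_eval (psi g)) in
    let p := \prod_(g <- s1) g in
    top u = top p /\ length_le (range sub_gen) (cL * size s1) (u * p^-1 * inT (top p)).
  elim: s1 => [|g s1 IHs] sL.
    by rewrite /= !big_nil mulgV mul1g; split=> //; apply: length_le1.
  have [|/= tops len] := IHs; first by move=> g' gs; apply: sL; rewrite inE gs orbT.
  move: tops len; rewrite /= !big_cons; set u := \prod_(g <- _) _; set p := \prod_(g <- _) _.
  move=> tops len.
  have phig : phi (free_metabelian_eval (psi g)) = g * nu g by rewrite mulVKg.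
  have len_g : length_le (range sub_gen) cL (inT (top g) * nu g).
    exact/cLP/map_f/sL/mem_head.
  rewrite phig; move: (nu g) (nuN g) len_g => v Nv len_g.
  rewrite !topM (ncl_top Nv) mulg1 tops; split=> //.
  rewrite mulnS wreath_inTM.
  suff -> : g * v * u * (g * p)^-1 * (inT (top g) * inT (top p)) =
      inT (top g) * v * (u * p^-1 * inT (top p)).
    exact: length_leM.
  have base1 : top (v * (u * p^-1)) = 1.
    by rewrite !topM (ncl_top Nv) (morph_inv topM) tops mulgV mulg1.
  (* On a base element, conjugation by [g] and by its top coincide, which lets [g] be replaced by
     [inT (top g)]. *)
  have := base_conj_same commA (g := g^-1) (h := (inT (top g))^-1) base1.
  rewrite !(morph_inv topM) => /(_ erefl); rewrite !conjgE !invgK => conj_eq.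
  rewrite invgM !mulgA; move: conj_eq; rewrite !mulgA => ->.
  by rewrite mulgVK.
have [tops len] := diff s0 (in_Ls _ s0S).
move: tops len; rewrite h0s -(morph_prod phiM) -w0E (ncl_top Nh0) -[inT 1]/(1 : W) mulg1.
move=> _ len0; rewrite -[h](mulgVK (inT (top h))).
set h0 := h / inT (top h) in len0 *.
have len1 := C1P _ _ w01 w0n.
(* The first factor has linear length by [diff], the second is bounded by [relation_length]. *)
have -> : h0 = (phi (free_metabelian_eval w0) / h0)^-1 * phi (free_metabelian_eval w0).
  by rewrite invgF mulgVK.
have := cYP _ _ (length_leM (length_leM (length_leV len0) len1) Th).
apply: length_leW.
have dm : (delta (cW * (q * n)) <= delta ((cY * C2 + cW * q + 1) * n))%N.
  by apply: dehn_function_mono; rewrite (mulnA cW) leq_mul2r; apply/orP; right; lia.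
move: (delta _) (delta _) dm => d d' dd'.
apply: (@leq_trans (cY * (C2 * (d + n)))); last first.
  by rewrite (mulnA cY) leq_mul2r; apply/orP; right; rewrite -addnA leq_addr.
rewrite leq_mul2l; apply/orP; right; rewrite /C2 !mulnDl; apply: leq_add; first apply: leq_add.
- apply: (@leq_trans (cL * (q * n))); first by rewrite leq_mul2l s0n orbT.
  by rewrite -mulnA leq_mul2l leq_mul2l leq_addl !orbT.
- rewrite -mulnA leq_mul2l mulnDl mul1n mulnA leq_add ?orbT //.
    by rewrite (leq_trans dd') ?leq_addr.
  by rewrite leq_mul2l leq_addl orbT.
- by rewrite leq_mul2l (leq_trans sn) ?orbT ?leq_addl.
Qed.

End WreathQuotient.

(** * Trivial top group *)

Section AbelianDistortion.
Variable K : groupType.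
Hypothesis commK : forall x y : K, commute x y.
Implicit Types (H : set K) (es : seq K).

Lemma length_le_cons e es n g : length_le [set` e :: es] n g ->
  exists z n1 g1, [/\ (`|z| + n1 <= n)%N, length_le [set` es] n1 g1 & g = expgz e z * g1].
Proof.
move=> [s [sP <- sn]].
suff [z [n1 [g1 [zn len ->]]]] : exists z n1 g1, [/\ (`|z| + n1 <= size s)%N,
    length_le [set` es] n1 g1 & \prod_(u <- s) u = expgz e z * g1].
  by exists z, n1, g1; split=> //; apply: leq_trans sn.
elim: s sP {sn} => [|u s IHs] sP.
  exists (Posz 0), 0%N, 1; split=> //; first exact: length_le1.
  by rewrite big_nil /= mulg1.
have [|z [n1 [g1 [zn len pE]]]] := IHs; first by move=> v vs; apply: sP; rewrite inE vs orbT.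
have letter x b : x \in e :: es -> u = (if b then x^-1 else x) ->
    exists z n1 g1, [/\ (`|z| + n1 <= (size s).+1)%N,
      length_le [set` es] n1 g1 & \prod_(v <- u :: s) v = expgz e z * g1].
  rewrite inE => /predU1P [->|xes] ->.
    exists (z + (if b then -1 else 1))%R, n1, g1; split=> //; first by case: b; lia.
    rewrite big_cons pE mulgA; congr (_ * _); rewrite commK expgzD; congr (_ * _).
    by case: (b).
  exists z, n1.+1, ((if b then x^-1 else x) * g1); split; first by rewrite addnS ltnS.
    rewrite -add1n; apply: length_leM len.
    by case: (b); first apply: length_leV; apply: length_le_gen.
  by rewrite big_cons pE !mulgA; congr (_ * _); apply: commK.
have [uP|uP] := sP u (mem_head _ _); first exact: (letter u false).
by apply: (letter u^-1 true); rewrite ?invgK.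
Qed.

(** Induction on the generators. Elements of [H] involving [e] are reduced by Euclidean division by
    the least positive exponent of [e] occurring in [H]; the quotient is at most the length, so the
    reduction is linear. *)
Lemma subgroup_undistorted es H : is_subgroup H ->
  exists (ys : seq K) (C : nat), (forall y, y \in ys -> H y) /\
    forall n g, H g -> length_le [set` es] n g -> length_le [set` ys] (C * n) g.
Proof.
move=> [H1 HM HV]; elim: es => [|e es [ys [C [ysH ysP]]]].
  exists [::], 0%N; split=> // n g _ [[|u s] [sP <- _]]; first by rewrite big_nil; apply: length_le1.
  by case: (sP u (mem_head _ _)).
pose good d := (0 < d)%N /\ exists g, generated [set` es] g /\ H (e ^+ d * g).
(* A negative exponent of [e] is made positive by passing to the inverse of [g]. *)
have pos_case n g : H g -> length_le [set` e :: es] n g ->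
    exists2 z, (z <= n)%N & exists n1 g1, [/\ (z + n1 <= n)%N, length_le [set` es] n1 g1 &
      g = e ^+ z * g1 \/ g^-1 = e ^+ z * g1].
  move=> Hg /length_le_cons [z [n1 [g1 [zn len ->]]]]; exists `|z|%N; first by lia.
  case: z zn => z zn; first by exists n1, g1; split=> //; left.
  exists n1, g1^-1; split=> //; first exact: length_leV.
  by right; rewrite invgM /= invgK; apply: commK.
(* Without a good exponent, no element of [H] involves [e] and the old generators suffice. *)
have [goodE|nogood] := pselect (exists d, good d); last first.
  exists ys, C; split=> // n g Hg /(pos_case _ _ Hg) [z _ [n1 [g1 [zn len gE]]]].
  have z0 : z = 0%N.
    apply/eqP; rewrite -leqn0 leqNgt; apply/negP => z_gt0; apply: nogood.
    exists z; split=> //; exists g1; split; first exact: length_le_generated len.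
    by case: gE => <- //; apply: HV.
  move: zn gE; rewrite z0 add0n expg0 mul1g => n1n gE.
  apply: ysP => //; apply: length_leW n1n _; case: gE => [-> //|gE].
  by rewrite -[g]invgK gE; apply: length_leV.
have [d [d_gt0 [g0 [Eg0 Hp]]] dmin] : exists2 d, good d & forall d', good d' -> (d <= d')%N.
  have exd : exists d, `[< good d >] by case: goodE => d dP; exists d; apply/asboolP.
  case: (ex_minnP exd) => d /asboolP dP dmin; exists d => // d' d'P.
  by apply: dmin; apply/asboolP.
set p := e ^+ d * g0 in Hp.
have [c len_g0] := generated_length_le Eg0.
have HX q : H (p ^+ q) by elim: q => // q IHq; rewrite expgS; apply: HM.
exists (p :: ys), (C * (1 + c) + 1)%N; split=> [y|].
  by rewrite inE => /predU1P [->//|/ysH].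
have case_pos n g z n1 g1 : H g -> (z <= n)%N -> (z + n1 <= n)%N ->
    length_le [set` es] n1 g1 -> g = e ^+ z * g1 ->
    length_le [set` p :: ys] ((C * (1 + c) + 1) * n) g.
  move=> Hg zn zn1 len gE; pose q := (z %/ d)%N; pose r := (z %% d)%N.
  have gq : g * (p ^+ q)^-1 = e ^+ r * (g1 * (g0 ^+ q)^-1).
    rewrite /p expgMn // -expgnA mulnC gE {1}(divn_eq z d) -/q -/r addnC expgnDr.
    rewrite invgM -!mulgA; congr (_ * _).
    by rewrite (mulgA g1) (commK (e ^+ _)) mulgVK.
  have qn : (q <= n)%N by apply: leq_trans (leq_div _ _) zn.
  have len' : length_le [set` es] ((1 + c) * n) (g1 * (g0 ^+ q)^-1).
    apply: (@length_leW _ _ (n1 + q * c)); first by nia.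
    by apply: length_leM len _; apply/length_leV/length_leX.
  have Hgq : H (g * (p ^+ q)^-1) by apply: HM => //; apply: HV.
  (* A positive remainder would be a good exponent smaller than [d]. *)
  have r0 : r = 0%N.
    apply/eqP; rewrite -leqn0 leqNgt; apply/negP => r_gt0.
    have : good r.
      split=> //; exists (g1 * (g0 ^+ q)^-1); rewrite -gq.
      by split=> //; apply: length_le_generated len'.
    by move=> /dmin; rewrite leqNgt ltn_pmod.
  rewrite -[g](mulgVK (p ^+ q)) mulnDl -mulnA; apply: length_leM.
    have ys_sub u : [set` ys] u -> length_le [set` p :: ys] 1 u.
      by move=> uys; apply: length_le_gen; rewrite /= inE [u \in ys]uys orbT.
    rewrite -[X in length_le _ X _]mul1n; apply: length_le_trans ys_sub _.
    by apply: ysP => //; rewrite gq r0 expg0 mul1g.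
  apply: (@length_leW _ _ (q * 1)); first by rewrite muln1 mul1n.
  by apply/length_leX/length_le_gen; rewrite /= inE eqxx.
move=> n g Hg /(pos_case _ _ Hg) [z zn [n1 [g1 [zn1 len [gE|gE]]]]].
  exact: case_pos Hg zn zn1 len gE.
rewrite -[g]invgK; apply: length_leV.
exact: case_pos (HV _ Hg) zn zn1 len gE.
Qed.
End AbelianDistortion.

Local Close Scope group_scope.

Lemma distortion_trivial_top (A T : groupType) (S Y : {fset wreath A T}) (H : set (wreath A T)) :
  (forall x y : A, commute x y) -> (forall u : T, u = 1%g) ->
  generated [set` S] = [set: wreath A T] -> generated [set` Y] = H ->
  exists C, forall n, (distortion_function [set` S] H [set` Y] n <= C * n)%N.
Proof.
move=> commA T1 genS genY.
have commW (x y : wreath A T) : commute x y by apply: (base_commute commA); apply: T1.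
have subH : is_subgroup H by rewrite -genY; apply: generated_subgroup.
have [ys [C [ysH ysP]]] := subgroup_undistorted commW S subH.
have [|c cP] := @finite_length_bound _ ys [set` Y]; first by move=> y /ysH; rewrite genY.
exists (c * C) => n; apply: distortion_le => // g Hg gn.
by rewrite -mulnA; apply: length_le_trans cP _; apply: ysP.
Qed.

Theorem theoremA (m k l : nat) (A T : groupType)
    (a : 'I_m -> A) (t : 'I_k -> T)
    (ha : free_abelian_basis a) (ht : free_abelian_basis t)
    (f : 'I_l -> wreath A T) (hf : forall i : 'I_l, base_group A T (f i)) :
  let H : set (wreath A T) :=
    generated (range f `|` range (fun i : 'I_k => wreath_inT A (t i))) in
  let G : groupType := quotient_by (range f) in
  forall (S Y : {fset wreath A T}),
    generated [set` S] = [set: wreath A T] ->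
    generated [set` Y] = H ->
  forall P : relative_presentation G,
  let Delta := distortion_function [set` S] H [set` Y] in
  let delta := relative_dehn_function P in
  [/\ Delta \preccurlyeq (fun n => delta n ^ k + n ^ k)%N,
      delta \preccurlyeq (fun n => maxn (n ^ 3) (Delta (n ^ 2)%N ^ 3))%N
    & k = 1 -> Delta \preccurlyeq delta].
Proof.
move=> H G S Y genS genY P Delta delta.
have HE : H = generated (range (sub_gen t f)) by rewrite sub_gen_generated.
rewrite /Delta HE in genY *; clear Delta.
set Delta := distortion_function _ _ _.
have [C C_gt0 DeltaP] := distortion_le_dehn ha ht hf genS genY P.
have [c c_gt0 deltaP] := dehn_le_distortion ha ht hf genS genY P.
have leq_self_exp x e : (0 < e)%N -> (x <= x ^ e)%N.
  by case: x => // x e_gt0; rewrite -{1}[x.+1]expn1 leq_pexp2l.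
split.
(* For [k = 0] the bounding function is the constant 2, so the linear term in [dominated] has to
   absorb the distortion. *)
- case: (posnP k) => [k0|k_gt0].
    have T1 (u : T) : u = 1%g.
      by rewrite (coordE ht u) big1 // => i _; move: (ltn_ord i); rewrite {2}k0.
    have [b bP] := distortion_trivial_top ha.1 T1 genS genY.
    exists b.+1 => // n; apply: leq_trans (bP n) _.
    by rewrite mulSn; lia.
  exists C => // n; apply: leq_trans (DeltaP n) _; rewrite -addnA.
  apply: leq_trans (leq_addr _ _); rewrite leq_mul2l; apply/orP; right.
  apply: leq_add; first exact: leq_self_exp.
  by apply: leq_trans (leq_self_exp _ _ k_gt0); apply: leq_pmull.
- exists c => // n; apply: leq_trans (deltaP n) _; rewrite -addnA.
  apply: leq_trans (leq_addr _ _); rewrite leq_mul2l; apply/orP; right.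
  have n_le : (n <= c * n)%N by apply: leq_pmull.
  (* The argument [c * n] is at most its square, so monotonicity of the distortion function covers
     the case where it dominates. *)
  rewrite leq_max; case: (leqP n (Delta (c * n))) => nD; rewrite ?leq_exp2r ?n_le // orbC.
  by rewrite distortion_mono // leq_self_exp.
- move=> _; exists C => // n; apply: leq_trans (DeltaP n) _.
  by rewrite mulnDr leq_addr.
Qed.
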